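(* Let $\mathcal P$ be a $(\lambda_1,\lambda_2)$-good grid of a finite measure space $(I,\mathbb A,m)$, $s>0$, $p\in[1,\infty)$, $q\in[1,\infty]$. Let $\mathcal A$ be a class of $(s,p,u)$-atoms, with $u\ge1$, such that for some $\beta>s$, $\tilde q\in[1,\infty]$ and constants $K_1,K_2\ge0$ we have, for every $Q\in\mathcal P$, $$\frac1{K_1}\mathcal A^{sz}_{s,p}(Q)\subset\mathcal A(Q)\subset K_2\,\mathcal A^{bs}_{s,\beta,p,\tilde q}(Q).$$ Then $$\mathcal B^s_{p,q}(\mathcal P,\mathcal A^{sz}_{s,p})=\mathcal B^s_{p,q}(\mathcal P,\mathcal A)=\mathcal B^s_{p,q}(\mathcal P,\mathcal A^{bs}_{s,\beta,p,\tilde q}).$$ Moreover $$|f|_{\mathcal B^s_{p,q}(\mathcal A)}\le K_1|f|_{\mathcal B^s_{p,q}(\mathcal A^{sz}_{s,p})}\quad\text{and}\quad|f|_{\mathcal B^s_{p,q}(\mathcal A^{sz}_{s,p})}\le\frac{K_2}{1-\lambda_2^{\beta-s}}\,|f|_{\mathcal B^s_{p,q}(\mathcal A)}.$$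
   Context: $|J|=m(J)$; $|\cdot|_p$ is the $L^p(I,\mathbb A,m)$ norm; $u'$ is the conjugate exponent; $\mathbb N=\{0,1,\dots\}$; $\ell^\infty$ modifications (sup) when an exponent is $\infty$. For a set $X$ of functions and $c\ge0$, $cX=\{c\phi:\phi\in X\}$. Good grid ($0<\lambda_1<\lambda_2<1$): a sequence $\mathcal P=(\mathcal P^k)_{k\in\mathbb N}$ of finite families of measurable sets of positive measure with: $\mathcal P^0=\{I\}$; $I=\bigcup_{Q\in\mathcal P^k}Q$ up to a null set; the elements of $\mathcal P^k$ are pairwise disjoint; every $Q\in\mathcal P^k$, $k>0$, is contained in some $P\in\mathcal P^{k-1}$; $\lambda_1\le|Q|/|P|\le\lambda_2$ whenever $Q\subset P$, $Q\in\mathcal P^{k+1}$, $P\in\mathcal P^k$; $\bigcup_k\mathcal P^k$ generates $\mathbb A$. Also $\mathcal P$ denotes $\bigcup_k\mathcal P^k$. Class of $(s,p,u)$-atoms: a family $\mathcal A=(\mathcal B(Q),\mathcal A(Q))_{Q\in\mathcal P}$ where $\mathcal B(Q)$ is a complex Banach space contained in $L^{pu}$ whose elements vanish outside $Q$; $\mathcal A(Q)\subset\mathcal B(Q)$ is convex, $\phi\in\mathcal A(Q)$ iff $\sigma\phi\in\mathcal A(Q)$ for all $|\sigma|=1$; and $|\phi|_{pu}\le|Q|^{s-\frac1{u'p}}$ for all $\phi\in\mathcal A(Q)$. $\mathcal B^s_{p,q}(\mathcal A)=\mathcal B^s_{p,q}(\mathcal P,\mathcal A)=\mathcal B^s_{p,q}(I,\mathcal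 P,\mathcal A)$: the set of complex $g\in L^p$ with $g=\sum_k\sum_{Q\in\mathcal P^k}s_Qa_Q$, $a_Q\in\mathcal A(Q)$, $s_Q\in\mathbb C$, $\sum_k|\sum_{Q\in\mathcal P^k}s_Qa_Q|_p<\infty$, and finite cost $(\sum_k(\sum_{Q\in\mathcal P^k}|s_Q|^p)^{q/p})^{1/q}$; $|g|_{\mathcal B^s_{p,q}(\mathcal A)}$ is the infimum of the costs. $\mathcal A^{sz}_{s,p}(Q)$ is the set of $(s,p)$-Souza's atoms on $Q$: functions constant on $Q$, zero outside $Q$, with sup norm $\le|Q|^{s-1/p}$. Besov's atoms: for $Q\in\mathcal P^{k_0}$ let $\mathcal P_Q=(\mathcal P_Q^i)_{i\ge0}$, $\mathcal P^i_Q=\{P\in\mathcal P^{k_0+i}:P\subset Q\}$, and let $\mathcal B^\beta_{p,\tilde q}(Q,\mathcal P_Q,\mathcal A^{sz}_{\beta,p})$ be the set of complex $g\in L^p$ vanishing outside $Q$ that can be written $g=\sum_{i\ge0}\sum_{P\in\mathcal P_Q^i}s_Pa_P$ with $s_P\in\mathbb C$, $a_P\in\mathcal A^{sz}_{\beta,p}(P)$ (i.e. $a_P$ is constant on $P$, zero outside $P$, with sup norm $\le|P|^{\beta-1/p}$), $\sum_i|\sum_{P\in\mathcal P_Q^i}s_Pa_P|_p<\infty$, and finite cost $(\sum_i(\sum_{P\in\mathcal P_Q^i}|s_P|^p)^{\tilde q/p})^{1/\tilde q}$; its norm $|g|_{\mathcal B^\beta_{p,\tilde q}(Q,\mathcal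 P_Q,\mathcal A^{sz}_{\beta,p})}$ is the infimum of these costs over all such representations. For $s<\beta$, $\tilde q\in[1,\infty]$, $\mathcal A^{bs}_{s,\beta,p,\tilde q}(Q)$ is the set of functions $a\in\mathcal B^\beta_{p,\tilde q}(Q,\mathcal P_Q,\mathcal A^{sz}_{\beta,p})$, zero outside $Q$, with $$|a|_{\mathcal B^\beta_{p,\tilde q}(Q,\mathcal P_Q,\mathcal A^{sz}_{\beta,p})}\le\frac1{C_b}|Q|^{s-\beta},\qquad C_b=\Big(\sum_{k\ge0}\lambda_2^{k\beta\tilde q}\Big)^{1/\tilde q}\ (=1\text{ if }\tilde q=\infty).$$ *)

(* Defs.v *)
From HB Require Import structures.
From mathcomp Require Import all_boot all_order all_algebra.
From mathcomp Require Import complex.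
From mathcomp Require Import all_classical all_reals all_analysis.

Set Implicit Arguments.
Unset Strict Implicit.
Unset Printing Implicit Defensive.

Import Order.TTheory GRing.Theory Num.Theory.
Import numFieldNormedType.Exports.

Local Open Scope classical_set_scope.
Local Open Scope ring_scope.
Local Open Scope complex_scope.

(* Elements of the complex space L^r(m) are represented by measurable functions
   T -> R[i].  A set of elements of L^r(m) is a set of such representatives
   stable under almost everywhere equality, so that equality of sets of
   functions below is equality of the corresponding sets of classes. *)

Section ComplexLp.
Context (R : realType) (d : measure_display) (T : measurableType d).
Context (m : {finite_measure set T -> \bar R}).
Implicit Types (f g : T -> R[i]) (Q : set T).

Definition cmeasurable f : Prop :=
  measurable_fun setT (fun x => complex.Re (f x)) /\
  measurable_fun setT (fun x => complex.Im (f x)).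

Definition cLnorm (r : \bar R) f : \bar R :=
  Lnorm m r (fun x => (ComplexField.Normc.normc (f x))%:E).

Definition cLfun (r : \bar R) : set (T -> R[i]) :=
  [set f | cmeasurable f /\ (cLnorm r f < +oo)%E].

Definition vanishes_outside Q f : Prop := {ae m, forall x, ~ Q x -> f x = 0}.

Definition vol Q : R := fine (m Q).

Definition scale_set (c : R) (X : set (T -> R[i])) : set (T -> R[i]) :=
  [set (fun x => c%:C * phi x) | phi in X].

End ComplexLp.

Section Grids.
Context (R : realType) (d : measure_display) (T : measurableType d).
Context (m : {finite_measure set T -> \bar R}).
Implicit Types (P : nat -> set (set T)).

Definition cells P : set (set T) := [set Q | exists k, P k Q].

Record good_grid (lambda1 lambda2 : R) P : Prop := {
  good_grid_lambda : 0 < lambda1 /\ lambda1 < lambda2 /\ lambda2 < 1;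
  good_grid_finite : forall k, finite_set (P k);
  good_grid_measurable : forall k Q, P k Q -> measurable Q /\ (0 < m Q)%E;
  good_grid_root : P 0%N = [set setT];
  good_grid_cover : forall k, m.-negligible (~` \bigcup_(Q in P k) Q);
  good_grid_disjoint : forall k, trivIset (P k) id;
  good_grid_nested : forall k Q, P k.+1 Q -> exists2 J, P k J & Q `<=` J;
  good_grid_ratio : forall k Q J, P k.+1 Q -> P k J -> Q `<=` J ->
    lambda1 <= vol m Q / vol m J <= lambda2;
  good_grid_generates : <<s cells P >> = @measurable d T
}.

(* The grid P_Q induced on Q; in a good grid the level k0 of Q is unique. *)
Definition subgrid P (Q : set T) : nat -> set (set T) :=
  fun i => [set J | exists k0, [/\ P k0 Q, P (k0 + i)%N J & J `<=` Q]].

End Grids.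

Section Besov.
Context (R : realType) (d : measure_display) (T : measurableType d).
Context (m : {finite_measure set T -> \bar R}).
Implicit Types (P : nat -> set (set T)) (A : set T -> set (T -> R[i])).
Implicit Types (s p beta : R) (q : \bar R) (g : T -> R[i]).

Definition level_sum P (c : set T -> R[i]) (a : set T -> T -> R[i]) (k : nat) :
    T -> R[i] :=
  fun x => \sum_(Q \in P k) c Q * a Q x.

(* The l^q norm over k of the l^p norms (\sum_(Q in P k) |c Q|^p)^(1/p);
   Lnorm counting +oo is the supremum. *)
Definition cost P p q (c : set T -> R[i]) : \bar R :=
  Lnorm (@counting nat R) q (fun k =>
    ((\sum_(Q \in P k) (ComplexField.Normc.normc (c Q)) `^ p) `^ p^-1)%:E).

Definition representation P A p q g (c : set T -> R[i])
    (a : set T -> T -> R[i]) : Prop :=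
  [/\ forall Q, cells P Q -> A Q (a Q),
      (\sum_(0 <= k <oo) cLnorm m p%:E (level_sum P c a k) < +oo)%E,
      cLnorm m p%:E (fun x => g x - \sum_(0 <= k < n) level_sum P c a k x)
        @[n --> \oo] --> 0%E
    & (cost P p q c < +oo)%E].

Definition besov_space P A p q : set (T -> R[i]) :=
  [set g | cLfun m p%:E g /\ exists c a, representation P A p q g c a].

Definition besov_norm P A p q g : \bar R :=
  ereal_inf [set x | exists c a, representation P A p q g c a /\
                                 x = cost P p q c].

Definition souza_atoms s p (Q : set T) : set (T -> R[i]) :=
  [set f | cmeasurable f /\ exists z : R[i],
     f = (fun x => z * (\1_Q x : R)%:C) %[ae m] /\
     ComplexField.Normc.normc z <= vol m Q `^ (s - p^-1)].

Definition besov_const (lambda2 beta : R) (q : \bar R) : \bar R :=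
  match q with
  | r%:E => ((\sum_(0 <= k <oo) (lambda2 `^ (k%:R * beta * r))%:E) `^ (r^-1)%R)%E
  | _ => 1%E
  end.

Definition besov_atoms P (lambda2 s beta p : R) (q : \bar R) (Q : set T) :
    set (T -> R[i]) :=
  [set a | [/\ besov_space (subgrid P Q) (souza_atoms beta p) p q a,
      vanishes_outside m Q a
    & (besov_norm (subgrid P Q) (souza_atoms beta p) p q a <=
       ((fine (besov_const lambda2 beta q))^-1 *
        vol m Q `^ (s - beta))%:E)%E]].

End Besov.

(* A class of (s,p,u)-atoms.  The complex Banach space B(Q) is realised inside
   L^(pu) by the injective linear map ac_emb, which chooses a representative
   of each element and is therefore linear only up to a null set.
   In the last field the term fine (...) is 1/(u'p), equal to 0 when u = 1
   (u' = +oo) and to 1/p when u = +oo. *)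
Record atom_class (R : realType) (d : measure_display) (T : measurableType d)
    (m : {finite_measure set T -> \bar R}) (P : nat -> set (set T))
    (s p : R) (u : \bar R) := AtomClass {
  ac_space : set T -> completeNormedModType R[i];
  ac_emb : forall Q, ac_space Q -> T -> R[i];
  ac_atoms : set T -> set (T -> R[i]);
  ac_emb_Lp : forall Q, cells P Q -> forall v : ac_space Q,
    cLfun m (p%:E * u)%E (ac_emb v);
  ac_emb_linear : forall Q, cells P Q -> forall (a : R[i]) (v w : ac_space Q),
    ac_emb (a *: v + w) =
      (fun x => a * ac_emb v x + ac_emb w x) %[ae m];
  ac_emb_inj : forall Q, cells P Q -> forall v w : ac_space Q,
    ac_emb v = ac_emb w %[ae m] -> v = w;
  ac_emb_vanish : forall Q, cells P Q -> forall v : ac_space Q,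
    vanishes_outside m Q (ac_emb v);
  ac_atoms_sub : forall Q, cells P Q -> forall phi, ac_atoms Q phi ->
    cmeasurable phi /\ exists v : ac_space Q, phi = ac_emb v %[ae m];
  ac_atoms_ae : forall Q, cells P Q -> forall phi psi, ac_atoms Q phi ->
    cmeasurable psi -> phi = psi %[ae m] -> ac_atoms Q psi;
  ac_atoms_convex : forall Q, cells P Q -> forall phi psi (t : R),
    ac_atoms Q phi -> ac_atoms Q psi -> 0 <= t <= 1 ->
    ac_atoms Q (fun x => t%:C * phi x + (1 - t)%:C * psi x);
  ac_atoms_balanced : forall Q, cells P Q -> forall phi (sigma : R[i]),
    `|sigma| = 1 -> (ac_atoms Q phi <-> ac_atoms Q (fun x => sigma * phi x));
  ac_atoms_norm : forall Q, cells P Q -> forall phi, ac_atoms Q phi ->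
    (cLnorm m (p%:E * u) phi <=
     (vol m Q `^ (s - fine ((hoelder_conjugate u * p%:E)^-1)%E))%:E)%E
}.

(* Main.v *)
Require Import Defs.
From mathcomp Require Import all_boot all_order all_algebra.
From mathcomp Require Import complex ring.
From mathcomp Require Import all_classical all_reals all_analysis.
From mathcomp Require Import measurable_realfun ess_sup_inf.

Set Implicit Arguments.
Unset Strict Implicit.
Unset Printing Implicit Defensive.

Import Order.TTheory GRing.Theory Num.Theory.
Import numFieldNormedType.Exports.
Local Open Scope classical_set_scope.
Local Open Scope ring_scope.
Local Notation normc := ComplexField.Normc.normc.
Local Notation "x %:C" := (real_complex _ x) : ring_scope.

(* Only the inclusion of the space of Besov's atoms in that of Souza's atoms needs
   work.  Write f = sum_Q c_Q b_Q, expand every atom as b_Q = sum_(J in Q) y_(Q,J) 1_J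
   at a cost at most (1 + e) |Q|^(s - beta), and let g_k(J) = c_Q y_(Q,J), with Q the
   cell of level k containing J.  As |J| <= lambda2^i |Q| for J of level k + i,
   the normalized l^p norm of g_k on level k + i is at most
   (1 + e) mu^i S_k, with mu = lambda2^(beta - s) and S_k the l^p norm of c on level k.
   Summing the g_k for k <= j gives the coefficients on level j; by Minkowski's
   inequality their level norms are bounded by the convolution of S with (mu^i),
   whose l^q norm is at most |S|_q / (1 - mu).  A step function on level j
   has L^p norm at most lambda2^(j s) |I|^s times the normalized norm of its
   coefficients, so all rearrangements converge geometrically in L^p. *)

(** * The complex modulus, one-term sums and extended powers *)

Lemma normc_ge0 (R : rcfType) (z : R[i]) : 0 <= normc z.
Proof. by case: z => a b; rewrite /= sqrtr_ge0. Qed.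
#[local] Hint Extern 0 (is_true (@Order.le _ _ _ (ComplexField.Normc.normc _))) =>
  solve [exact: normc_ge0] : core.

Lemma ler_normcD (R : rcfType) (x y : R[i]) : normc (x + y) <= normc x + normc y.
Proof. exact: le_normcD. Qed.

Lemma normc_real (R : rcfType) (a : R) : normc a%:C = `|a|.
Proof. by rewrite /= expr0n/= addr0 sqrtr_sqr. Qed.

Lemma ler_normc_sum (R : rcfType) (I : Type) (r : seq I) (F : I -> R[i]) :
  normc (\sum_(i <- r) F i) <= \sum_(i <- r) normc (F i).
Proof.
elim/big_rec2: _ => [|i y x _ xy]; first by rewrite ComplexField.Normc.normc0.
by rewrite (le_trans (ler_normcD _ _))// lerD2l.
Qed.

Lemma big_seq_single (V : nmodType) (I : eqType) (r : seq I) (i0 : I) (F : I -> V) :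
  uniq r -> i0 \in r -> (forall i, i \in r -> i != i0 -> F i = 0) ->
  \sum_(i <- r) F i = F i0.
Proof.
move=> ur i0r F0; rewrite (bigD1_seq i0)//= [X in _ + X]big_seq_cond big1 ?addr0//.
by move=> i /andP[ir ii0]; exact: F0.
Qed.

Lemma ge0_le_poweR (R : realType) (r : R) (x y : \bar R) : 0 <= r ->
  (0 <= x)%E -> (x <= y)%E -> (x `^ r <= y `^ r)%E.
Proof.
move=> r0 x0 xy; apply: gt0_ler_poweR => //; rewrite in_itv/= leey andbT//.
exact: le_trans xy.
Qed.

(** * Complex measurable functions, their [L^p] norm, and step functions *)

Section cLp.
Context {R : realType} {d : measure_display} {T : measurableType d}.
Variable m : {finite_measure set T -> \bar R}.
Implicit Types (f g : T -> R[i]) (p : R).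

Lemma measurableT_comp_powR (h : T -> R) p :
  measurable_fun setT h -> measurable_fun setT (fun x => h x `^ p).
Proof. exact: (@measurableT_comp _ _ _ _ _ _ (@powR R ^~ p)). Qed.

Lemma cmeasurableD f g : cmeasurable f -> cmeasurable g ->
  cmeasurable (fun x => f x + g x).
Proof.
move=> [f1 f2] [g1 g2]; split.
  under eq_fun do rewrite raddfD/=.
  exact: measurable_funD.
under eq_fun do rewrite raddfD/=.
exact: measurable_funD.
Qed.

Lemma cmeasurableM f g : cmeasurable f -> cmeasurable g ->
  cmeasurable (fun x => f x * g x).
Proof.
have reM (a b : R[i]) : complex.Re (a * b) =
  complex.Re a * complex.Re b - complex.Im a * complex.Im b.
  by case: a => ? ?; case: b => ? ?.
have imM (a b : R[i]) : complex.Im (a * b) =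
  complex.Re a * complex.Im b + complex.Im a * complex.Re b.
  by case: a => ? ?; case: b => ? ?.
move=> [f1 f2] [g1 g2]; split.
  under eq_fun do rewrite reM.
  by apply: measurable_funB; exact: measurable_funM.
under eq_fun do rewrite imM.
by apply: measurable_funD; exact: measurable_funM.
Qed.

Lemma cmeasurable_cst (z : R[i]) : cmeasurable (fun _ : T => z).
Proof. by split; exact: measurable_cst. Qed.

Lemma cmeasurableN f : cmeasurable f -> cmeasurable (fun x => - f x).
Proof.
move=> mf; under eq_fun do rewrite -mulN1r.
by apply: cmeasurableM => //; exact: cmeasurable_cst.
Qed.

Lemma cmeasurableB f g :
  cmeasurable f -> cmeasurable g -> cmeasurable (fun x => f x - g x).
Proof. by move=> mf mg; apply: cmeasurableD => //; exact: cmeasurableN. Qed.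

Lemma cmeasurable_sum (I : eqType) (r : seq I) (F : I -> T -> R[i]) :
  (forall i, i \in r -> cmeasurable (F i)) ->
  cmeasurable (fun x => \sum_(i <- r) F i x).
Proof.
elim: r => [|i r IH] mF.
  by under eq_fun do rewrite big_nil; exact: cmeasurable_cst.
under eq_fun do rewrite big_cons.
apply: cmeasurableD; first by apply: mF; rewrite mem_head.
by apply: IH => j jr; apply: mF; rewrite inE jr orbT.
Qed.

Lemma cmeasurable_indic (Q : set T) : measurable Q ->
  cmeasurable (fun x => (\1_Q x : R)%:C).
Proof. by move=> mQ; split => /=; [exact: measurable_indic|exact: measurable_cst]. Qed.

Lemma measurable_normc f : cmeasurable f -> measurable_fun setT (fun x => normc (f x)).
Proof.
move=> [f1 f2].
(* The modulus is written as a power with exponent 1/2, so that measurability of real powers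
   applies. *)
rewrite (_ : (fun _ => _) = fun x =>
  (complex.Re (f x) ^+ 2 + complex.Im (f x) ^+ 2) `^ 2^-1).
  apply: measurableT_comp_powR.
  by apply: measurable_funD; apply: measurable_funX.
apply/funext => x /=; rewrite powR12_sqrt ?addr_ge0 ?sqr_ge0//.
by case: (f x).
Qed.

Lemma cLnorm_ge0 (r : \bar R) f : (0 <= cLnorm m r f)%E.
Proof. exact: Lnorm_ge0. Qed.

Lemma eq_cLnorm r f g : f =1 g -> cLnorm m r f = cLnorm m r g.
Proof. by move=> /funext ->. Qed.

Lemma cLnormE p f : cLnorm m p%:E f = ((\int[m]_x (normc (f x) `^ p)%:E) `^ p^-1)%E.
Proof.
rewrite /cLnorm unlock; congr (_ `^ _)%E.
apply: eq_integral => x _; rewrite abse_EFin ger0_norm ?normc_ge0// poweR_EFin.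
Qed.

Lemma ae_eq_cLnorm p f g : 0 < p -> cmeasurable f -> cmeasurable g ->
  f = g %[ae m] -> cLnorm m p%:E f = cLnorm m p%:E g.
Proof.
move=> p0 mf mg fg; rewrite !cLnormE; congr (_ `^ _)%E.
apply: ae_eq_integral => //.
- by apply/measurable_EFinP/measurableT_comp_powR/measurable_normc.
- by apply/measurable_EFinP/measurableT_comp_powR/measurable_normc.
- by move: fg; apply: filterS => x /= h _; rewrite (h I).
Qed.

(** Minkowski's inequality for the two real moduli, combined with the pointwise triangle inequality
    for [normc]. *)
Lemma cLnormD p f g : 1 <= p -> cmeasurable f -> cmeasurable g ->
  (cLnorm m p%:E (fun x => f x + g x)%R <= cLnorm m p%:E f + cLnorm m p%:E g)%E.
Proof.
move=> p1 mf mg.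
have := @minkowski_EFin _ T R m (fun x => normc (f x)) (fun x => normc (g x)) p
  (measurable_normc mf) (measurable_normc mg) p1.
apply: le_trans.
have p0 : 0 < p by exact: lt_le_trans p1.
rewrite /cLnorm unlock; apply: ge0_le_poweR; first by rewrite invr_ge0 ltW.
- by apply: integral_ge0 => x _; exact: poweR_ge0.
apply: ge0_le_integral => //.
- by move=> x _; exact: poweR_ge0.
- under eq_fun do rewrite abse_EFin poweR_EFin.
  apply/measurable_EFinP/measurableT_comp_powR/measurableT_comp => //.
  by apply: measurable_normc; exact: cmeasurableD.
- under eq_fun do rewrite abse_EFin poweR_EFin.
  apply/measurable_EFinP/measurableT_comp_powR/measurableT_comp => //.
  by apply: measurable_funD; exact: measurable_normc.
move=> x _; rewrite !abse_EFin !poweR_EFin lee_fin /=.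
apply: ge0_ler_powR; rewrite ?nnegrE//; first exact: ltW.
by rewrite !ger0_norm ?addr_ge0//; exact: ler_normcD.
Qed.

Lemma cLnormZ p (z : R[i]) f : 0 < p -> cmeasurable f ->
  cLnorm m p%:E (fun x => z * f x) = ((normc z)%:E * cLnorm m p%:E f)%E.
Proof.
move=> p0 mf; rewrite !cLnormE.
under eq_integral do rewrite ComplexField.Normc.normcM powRM// EFinM.
rewrite ge0_integralZl//; first last.
- by rewrite lee_fin powR_ge0.
- by move=> x _; rewrite lee_fin powR_ge0.
- by apply/measurable_EFinP/measurableT_comp_powR/measurable_normc.
rewrite poweRM ?lee_fin ?powR_ge0//; last first.
  by apply: integral_ge0 => x _; rewrite lee_fin powR_ge0.
by rewrite poweR_EFin -powRrM divff ?gt_eqF// powRr1.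
Qed.

Lemma cLnorm0 p : 0 < p -> cLnorm m p%:E (fun=> 0) = 0%E.
Proof.
move=> p0; rewrite -(@Lnorm0 _ _ _ m p%:E) ?eqe ?gt_eqF//.
by apply: eq_Lnorm => x; rewrite ComplexField.Normc.normc0.
Qed.

Lemma cLnorm_sum p (I : eqType) (r : seq I) (F : I -> T -> R[i]) : 1 <= p ->
  (forall i, i \in r -> cmeasurable (F i)) ->
  (cLnorm m p%:E (fun x => \sum_(i <- r) F i x)%R <=
   \sum_(i <- r) cLnorm m p%:E (F i))%E.
Proof.
move=> p1; have p0 : 0 < p by exact: lt_le_trans p1.
elim: r => [|i r IH] mF.
  by rewrite big_nil; under eq_fun do rewrite big_nil; rewrite cLnorm0.
rewrite big_cons; under eq_fun do rewrite big_cons.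
apply: le_trans (cLnormD p1 _ _) _.
- by apply: mF; rewrite mem_head.
- by apply: cmeasurable_sum => j jr; apply: mF; rewrite inE jr orbT.
- by rewrite leeD2l// IH// => j jr; apply: mF; rewrite inE jr orbT.
Qed.

Definition step (r : seq (set T)) (z : set T -> R[i]) : T -> R[i] :=
  fun x => \sum_(Q <- r) z Q * (\1_Q x)%:C.

Lemma cmeasurable_step (r : seq (set T)) z : (forall Q, Q \in r -> measurable Q) ->
  cmeasurable (step r z).
Proof.
move=> mr; apply: cmeasurable_sum => Q Qr.
by apply: cmeasurableM; [exact: cmeasurable_cst|exact/cmeasurable_indic/mr].
Qed.

(** As the sets in [r] are disjoint, at most one term is nonzero at each point, so the [p]-th power
    of the modulus passes inside the sum and the integral is computed term by term. *)
Lemma cLnorm_step p (r : seq (set T)) z : 0 < p -> uniq r ->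
  (forall Q, Q \in r -> measurable Q) ->
  (forall Q J, Q \in r -> J \in r -> Q `&` J !=set0 -> Q = J) ->
  cLnorm m p%:E (step r z) =
    ((\sum_(Q <- r) normc (z Q) `^ p * vol m Q) `^ p^-1)%:E.
Proof.
move=> p0 ur mr dr; rewrite cLnormE -poweR_EFin; congr (_ `^ _)%E.
have E x : normc (step r z x) `^ p = \sum_(Q <- r) normc (z Q) `^ p * \1_Q x.
  have [[Q Qr Qx]|nQ] := pselect (exists2 Q, Q \in r & Q x).
    have d0 J : J \in r -> J != Q -> \1_J x = 0 :> R.
      move=> Jr JQ; rewrite indicE memNset// => Jx.
      by move/eqP: JQ; apply; apply: dr => //; exists x.
    have Q1 : \1_Q x = 1 :> R by rewrite indicE mem_set.
    rewrite /step (@big_seq_single _ _ _ Q)// ?(@big_seq_single _ _ _ Q)//.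
    - by rewrite Q1 !mulr1.
    - by move=> J Jr JQ; rewrite d0// mulr0.
    - by move=> J Jr JQ; rewrite d0// mulr0.
  have d0 J : J \in r -> \1_J x = 0 :> R.
    by move=> Jr; rewrite indicE memNset// => Jx; apply: nQ; exists J.
  rewrite /step big_seq big1 => [|J Jr]; last by rewrite d0// mulr0.
  rewrite big_seq big1 => [|J Jr]; last by rewrite d0// mulr0.
  by rewrite ComplexField.Normc.normc0 powR0// gt_eqF.
under eq_integral do rewrite E -sumEFin big_seq big_mkcond.
rewrite ge0_integral_sum//; first last.
- by move=> Q x _; case: ifPn => // _; rewrite lee_fin mulr_ge0// powR_ge0.
- move=> Q; case: (boolP (Q \in r)) => Qr; last exact: measurable_cst.
  apply/measurable_EFinP; apply: measurable_funM => //.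
  exact/measurable_indic/mr.
rewrite -sumEFin [RHS]big_seq [RHS]big_mkcond/=; apply: eq_bigr => Q _.
case: (boolP (Q \in r)) => Qr; last by rewrite integral0.
under eq_integral do rewrite EFinM.
rewrite ge0_integralZl//; last 2 first.
- by apply/measurable_EFinP/measurable_indic/mr.
- by rewrite lee_fin powR_ge0.
rewrite integral_indic ?setIT//; last exact: mr.
rewrite EFinM /vol fineK//; apply: fin_num_measure; exact: mr.
Qed.

End cLp.

(** * Norms of sequences: Minkowski's and Young's inequalities *)

Section lq.
Context {R : realType}.
Implicit Types (f g S V : nat -> R) (r M mu : R) (q : \bar R).
Local Notation lnorm q f := (Lnorm (@counting nat R) q (fun k => (f k)%:E)).

Lemma lnorm_partial f r n : 0 < r -> (forall k, 0 <= f k) ->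
  (((\sum_(0 <= k < n) f k `^ r) `^ r^-1)%:E <= lnorm r%:E f)%E.
Proof.
move=> r0 f0; rewrite Lnorm_counting// -poweR_EFin.
apply: ge0_le_poweR; first by rewrite invr_ge0 ltW.
  by rewrite lee_fin sumr_ge0// => k _; rewrite powR_ge0.
under eq_eseriesr do rewrite abse_EFin ger0_norm// poweR_EFin.
rewrite -sumEFin; apply: nneseries_lim_ge => k _.
by rewrite lee_fin powR_ge0.
Qed.

(** Together with [lnorm_partial], this reduces [l^r] estimates with finite [r] to real inequalities
    for finite sums, uniform in their length. *)
Lemma lnorm_le_partial f r M : 0 < r -> (forall k, 0 <= f k) -> 0 <= M ->
  (forall n, (\sum_(0 <= k < n) f k `^ r) `^ r^-1 <= M) -> (lnorm r%:E f <= M%:E)%E.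
Proof.
move=> r0 f0 M0 fM; rewrite Lnorm_counting//.
have -> : M%:E = ((M `^ r)%:E `^ r^-1)%E.
  by rewrite poweR_EFin -powRrM divff ?gt_eqF// powRr1.
apply: ge0_le_poweR; first by rewrite invr_ge0 ltW.
  by apply: nneseries_ge0 => k _ _; exact: poweR_ge0.
under eq_eseriesr do rewrite abse_EFin ger0_norm// poweR_EFin.
apply: lime_le.
  by apply: is_cvg_nneseries => k _; rewrite lee_fin powR_ge0.
apply: nearW => n; rewrite sumEFin lee_fin.
have s0 : 0 <= \sum_(0 <= k < n) f k `^ r.
  by rewrite sumr_ge0// => k _; rewrite powR_ge0.
have -> : \sum_(0 <= k < n) f k `^ r = ((\sum_(0 <= k < n) f k `^ r) `^ r^-1) `^ r.
  by rewrite -powRrM mulVf ?gt_eqF// powRr1.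
by apply: ge0_ler_powR; rewrite ?nnegrE ?powR_ge0// ltW.
Qed.

(** Finite sums become norms of truncated sequences, so that Minkowski's inequality for the counting
    measure yields the finite one in [ler_minkowski_nat]. *)
Lemma lnorm_trunc f r n : 0 < r -> (forall k, 0 <= f k) ->
  lnorm r%:E (fun k => if (k < n)%N then f k else 0) =
  ((\sum_(0 <= k < n) f k `^ r) `^ r^-1)%:E.
Proof.
move=> r0 f0.
have t0 k : 0 <= (if (k < n)%N then f k else 0) by case: ifP.
have E p : \sum_(0 <= k < p) (if (k < n)%N then f k else 0) `^ r <=
           \sum_(0 <= k < n) f k `^ r.
  have [pn|np] := leqP p n.
    rewrite [leRHS](big_cat_nat _ (n := p))//= -[leLHS]addr0 lerD//.
      rewrite !big_nat ler_sum// => k /andP[_ kp].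
      by rewrite (leq_trans kp pn).
    by rewrite sumr_ge0// => k _; rewrite powR_ge0.
  rewrite (big_cat_nat _ (n := n))//=; last exact: ltnW.
  rewrite [X in _ + X]big_nat_cond [X in _ + X]big1 ?addr0; last first.
    by move=> k /andP[/andP[nk _] _]; rewrite ltnNge nk/= powR0// gt_eqF.
  by rewrite !big_nat ler_sum// => k /andP[_ ->].
apply/eqP; rewrite eq_le; apply/andP; split.
  apply: lnorm_le_partial; [exact: r0|exact: t0|exact: powR_ge0|] => p.
  apply: ge0_ler_powR => //; rewrite ?nnegrE ?invr_ge0 ?(ltW r0)//.
  - by rewrite sumr_ge0// => k _; rewrite powR_ge0.
  - by rewrite sumr_ge0// => k _; rewrite powR_ge0.
rewrite (_ : \sum_(0 <= k < n) f k `^ r =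
  \sum_(0 <= k < n) (if (k < n)%N then f k else 0) `^ r).
  exact: lnorm_partial.
by rewrite !big_nat; apply: eq_bigr => k /andP[_ ->].
Qed.

Lemma ler_minkowski_nat f g r n : 1 <= r -> (forall k, 0 <= f k) -> (forall k, 0 <= g k) ->
  (\sum_(0 <= k < n) (f k + g k) `^ r) `^ r^-1 <=
  (\sum_(0 <= k < n) f k `^ r) `^ r^-1 + (\sum_(0 <= k < n) g k `^ r) `^ r^-1.
Proof.
move=> r1 f0 g0; have r0 : 0 < r by exact: lt_le_trans r1.
rewrite -lee_fin EFinD -[X in (_ <= X + _)%E](lnorm_trunc n r0 f0).
rewrite -[X in (_ <= _ + X)%E](lnorm_trunc n r0 g0).
rewrite -[X in (X <= _)%E](lnorm_trunc n r0 (fun k => addr_ge0 (f0 k) (g0 k))).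
have := @minkowski_EFin _ _ R (@counting nat R)
  (fun k => if (k < n)%N then f k else 0) (fun k => if (k < n)%N then g k else 0) r.
have mm (h : nat -> R) : measurable_fun setT h by [].
move=> /(_ (mm _) (mm _) r1); apply: le_trans.
rewrite le_eqVlt; apply/orP; left; apply/eqP; apply: eq_Lnorm => k /=.
by case: ifP; rewrite ?addr0.
Qed.

Lemma ler_minkowskiD (I : Type) (s : seq I) (f g : I -> R) r : 1 <= r ->
  (forall k, 0 <= f k) -> (forall k, 0 <= g k) ->
  (\sum_(k <- s) (f k + g k) `^ r) `^ r^-1 <=
  (\sum_(k <- s) f k `^ r) `^ r^-1 + (\sum_(k <- s) g k `^ r) `^ r^-1.
Proof.
(* Indexing a list by positions needs a default element, so the empty list is treated apart; both
   sides are then 0. *)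
case: s => [|i0 s] r1 f0 g0; last by rewrite !(big_nth i0); exact: ler_minkowski_nat.
by rewrite !big_nil powR0 ?addr0// invr_eq0 gt_eqF// (lt_le_trans _ r1).
Qed.

Lemma ler_minkowski_sum (I J : Type) (s : seq I) (t : seq J) (F : J -> I -> R) r : 1 <= r ->
  (forall j k, 0 <= F j k) ->
  (\sum_(k <- s) (\sum_(j <- t) F j k) `^ r) `^ r^-1 <=
  \sum_(j <- t) (\sum_(k <- s) F j k `^ r) `^ r^-1.
Proof.
move=> r1 F0; have r0 : 0 < r by exact: lt_le_trans r1.
elim: t => [|j t IH].
  rewrite big_nil big1 ?powR0 ?invr_eq0 ?gt_eqF// => k _.
  by rewrite big_nil powR0// gt_eqF.
rewrite [leRHS]big_cons.
rewrite (eq_bigr (fun k => (F j k + \sum_(j <- t) F j k) `^ r)); last first.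
  by move=> k _; rewrite big_cons.
apply: le_trans (ler_minkowskiD s r1 _ _) _ => //.
- by move=> k; exact: sumr_ge0.
- by rewrite lerD2l.
Qed.

Lemma le_powR_sum (I : eqType) (s : seq I) (A : pred I) (f g : I -> R) r : 0 < r ->
  (forall k, k \in s -> A k -> 0 <= f k <= g k) ->
  (\sum_(k <- s | A k) f k `^ r) `^ r^-1 <= (\sum_(k <- s | A k) g k `^ r) `^ r^-1.
Proof.
move=> r0 fg; apply: ge0_ler_powR; rewrite ?nnegrE ?invr_ge0 ?(ltW r0)//.
- by apply: sumr_ge0 => k _; exact: powR_ge0.
- by apply: sumr_ge0 => k _; exact: powR_ge0.
rewrite big_seq_cond [leRHS]big_seq_cond.
apply: ler_sum => k /andP[ks Ak]; have /andP[f0 le_fg] := fg k ks Ak.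
by apply: ge0_ler_powR; rewrite ?nnegrE ?(ltW r0)// (le_trans f0).
Qed.

(** A singleton has counting measure 1, so a null set for this measure is empty. *)
Lemma counting_ae (A : nat -> Prop) : {ae (@counting nat R), forall k, A k} -> forall k, A k.
Proof.
move=> [B [mB B0 AB]] k; apply: contrapT => nAk.
have : (@counting nat R [set k] <= @counting nat R B)%E.
  apply: le_measure; rewrite ?inE// => j ->; exact: AB.
by rewrite B0 /counting asboolT// fset_set1 finmap.cardfs1 lee_fin ler10.
Qed.

Lemma lnorm_infty_le f M : (lnorm +oo%E f <= M%:E)%E <-> forall k, `|f k| <= M.
Proof.
(* [Lnorm] at [+oo] is the essential supremum only when the whole space has positive measure. *)
have c0 : (0 < @counting nat R setT)%E.
  rewrite /counting asboolF ?ltry//; exact: infinite_nat.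
rewrite unlock /Lnorm c0; split=> [/ess_supP h k|h].
  by have := counting_ae h k; rewrite /= lee_fin.
by apply/ess_supP; apply: nearW => k /=; rewrite lee_fin.
Qed.

Lemma lnorm_ge_term f q k : (1 <= q)%E -> (forall k, 0 <= f k) ->
  ((f k)%:E <= lnorm q f)%E.
Proof.
move=> q1 f0; have [->|qoo] := eqVneq q +oo%E.
  have [->|] := eqVneq (lnorm +oo%E f) +oo%E; first by rewrite leey.
  move=> foo; have lf : lnorm +oo%E f \is a fin_num.
    by rewrite ge0_fin_numE ?Lnorm_ge0// lt_neqAle foo leey.
  rewrite -(fineK lf) lee_fin -[leLHS]ger0_norm//.
  by apply: (lnorm_infty_le _ _).1; rewrite fineK.
case: q q1 qoo => // r; rewrite lee_fin => r1 _.
have r0 : 0 < r by exact: lt_le_trans r1.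
apply: le_trans (lnorm_partial k.+1 r0 f0); rewrite lee_fin.
have -> : f k = (f k `^ r) `^ r^-1 by rewrite -powRrM divff ?gt_eqF// powRr1.
apply: ge0_ler_powR; rewrite ?nnegrE ?powR_ge0 ?invr_ge0 ?(ltW r0)//.
  by apply: sumr_ge0 => i _; exact: powR_ge0.
rewrite big_nat_recr//= lerDr; apply: sumr_ge0 => i _; exact: powR_ge0.
Qed.

(* Discrete Young inequality for convolution with a geometric sequence: the
   hypotheses hold with equality for [V n = \sum_(k <= n) mu ^ (n - k) S k]. *)
Lemma lnorm_geometric_convolution S V mu q : (1 <= q)%E -> 0 <= mu < 1 ->
  (forall k, 0 <= S k) -> (forall k, 0 <= V k) ->
  V 0%N <= S 0%N -> (forall n, V n.+1 <= mu * V n + S n.+1) ->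
  (lnorm q S < +oo)%E -> (lnorm q V <= (1 - mu)^-1%:E * lnorm q S)%E.
Proof.
move=> q1 /andP[mu0 mu1] S0 V0 VS0 VS Soo.
have lf : lnorm q S \is a fin_num by rewrite ge0_fin_numE ?Lnorm_ge0.
set N := fine (lnorm q S); have N0 : 0 <= N by rewrite fine_ge0// Lnorm_ge0.
have mu1' : 0 < 1 - mu by rewrite subr_gt0.
rewrite -(fineK lf) -EFinM -/N.
have SN k : S k <= N by rewrite -lee_fin fineK//; exact: lnorm_ge_term.
have C0 : 0 <= (1 - mu)^-1 * N by rewrite mulr_ge0// invr_ge0 ltW.
(* The target bound is the fixed point of [x = mu * x + N]; this closes both inductions below, on
   [k] for the supremum and on [n] for finite exponents. *)
have step : mu * ((1 - mu)^-1 * N) + N = (1 - mu)^-1 * N.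
  by field; rewrite gt_eqF.
have [qE|qoo] := eqVneq q +oo%E.
  rewrite qE; apply/lnorm_infty_le => k; rewrite ger0_norm//.
  elim: k => [|k IH].
    rewrite (le_trans VS0)// (le_trans (SN _))// -step lerDr.
    by rewrite mulr_ge0.
  by rewrite (le_trans (VS _))// -step lerD// ler_wpM2l.
case: q q1 qoo lf Soo @N N0 SN C0 step => // r.
rewrite lee_fin => r1 _ lf Soo N N0 SN C0 step.
have r0 : 0 < r by exact: lt_le_trans r1.
apply: lnorm_le_partial => // n.
elim: n => [|n IH].
  by rewrite big_nil powR0// invr_eq0 gt_eqF.
(* [W] is [mu * V] shifted by one place, so that [V k <= W k + S k] for every [k], including
   [k = 0]. The norm of [n + 1] terms of [W] is [mu] times that of [n] terms of [V], to which the
   induction hypothesis applies. *)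
pose W k := if k is k'.+1 then mu * V k' else 0.
have W0 k : 0 <= W k by case: k => //= k; rewrite mulr_ge0.
apply: (@le_trans _ _ ((\sum_(0 <= k < n.+1) (W k + S k) `^ r) `^ r^-1)).
  apply: le_powR_sum => // k _ _; rewrite V0/=; case: k => /= [|k]; first by rewrite add0r.
  exact: VS.
apply: le_trans (ler_minkowski_nat n.+1 r1 W0 S0) _.
rewrite -step lerD//; last first.
  by rewrite -lee_fin fineK//; exact: lnorm_partial.
rewrite big_nat_recl//= powR0 ?gt_eqF// add0r.
under eq_bigr do rewrite powRM//.
rewrite -mulr_sumr powRM ?powR_ge0//; last by apply: sumr_ge0 => i _; exact: powR_ge0.
by rewrite -powRrM divff ?gt_eqF// powRr1// ler_wpM2l.
Qed.

Lemma lnorm_le_scale f g C q : (1 <= q)%E -> 0 <= C -> (forall k, 0 <= g k) ->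
  (forall k, 0 <= f k <= C * g k) ->
  (lnorm q g < +oo)%E -> (lnorm q f <= C%:E * lnorm q g)%E.
Proof.
move=> q1 C0 g0 fg goo.
have lf : lnorm q g \is a fin_num by rewrite ge0_fin_numE ?Lnorm_ge0.
have N0 : 0 <= fine (lnorm q g) by rewrite fine_ge0// Lnorm_ge0.
have gN k : g k <= fine (lnorm q g) by rewrite -lee_fin fineK//; exact: lnorm_ge_term.
have f0 k : 0 <= f k by case/andP: (fg k).
rewrite -(fineK lf) -EFinM; have [qE|qoo] := eqVneq q +oo%E.
  rewrite {1}qE; apply/lnorm_infty_le => k; rewrite ger0_norm//.
  by have /andP[_ /le_trans] := fg k; apply; rewrite ler_wpM2l.
case: q q1 qoo goo lf N0 gN => // r; rewrite lee_fin => r1 _ goo lf N0 gN.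
have r0 : 0 < r by exact: lt_le_trans r1.
apply: lnorm_le_partial => // [|n]; first by rewrite mulr_ge0.
apply: (@le_trans _ _ ((\sum_(0 <= k < n) (C * g k) `^ r) `^ r^-1)).
  by apply: le_powR_sum => // k _ _; exact: fg.
under eq_bigr do rewrite powRM//.
rewrite -mulr_sumr powRM ?powR_ge0//; last by apply: sumr_ge0 => i _; exact: powR_ge0.
rewrite -powRrM divff ?gt_eqF// powRr1// ler_wpM2l//.
by rewrite -lee_fin fineK//; exact: lnorm_partial.
Qed.

End lq.

(** * Ancestors, volumes and levels of the cells of a good grid *)

Section Grid.
Context {R : realType} {d : measure_display} {T : measurableType d}.
Variable m : {finite_measure set T -> \bar R}.
Variables (lambda1 lambda2 : R) (P : nat -> set (set T)).
Hypothesis hP : good_grid m lambda1 lambda2 P.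

Lemma grid_measurable k Q : P k Q -> measurable Q.
Proof. by move=> /(good_grid_measurable hP)[]. Qed.

Lemma vol_gt0 k Q : P k Q -> 0 < vol m Q.
Proof.
move=> PQ; have [mQ Q0] := good_grid_measurable hP PQ.
by rewrite /vol fine_gt0// Q0/= -ge0_fin_numE ?measure_ge0// fin_num_measure.
Qed.

Lemma cell_nonempty k Q : P k Q -> Q !=set0.
Proof.
move=> /[dup] /(good_grid_measurable hP)[_ Q0] PQ; apply/set0P/eqP => E.
by move: Q0; rewrite E measure0 ltxx.
Qed.

Lemma grid_meet_eq k Q J : P k Q -> P k J -> Q `&` J !=set0 -> Q = J.
Proof. by move=> PQ PJ QJ; exact: (good_grid_disjoint hP PQ PJ QJ). Qed.

Lemma grid_ancestor k i J : P (k + i)%N J -> exists2 Q, P k Q & J `<=` Q.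
Proof.
elim: i J => [|i IH] J; first by rewrite addn0 => PJ; exists J.
rewrite addnS => /(good_grid_nested hP)[J' PJ' JJ'].
have [Q PQ J'Q] := IH _ PJ'.
by exists Q => //; exact: subset_trans J'Q.
Qed.

Lemma grid_ancestor_unique k i J Q Q' : P (k + i)%N J ->
  P k Q -> P k Q' -> J `<=` Q -> J `<=` Q' -> Q = Q'.
Proof.
move=> PJ PQ PQ' JQ JQ'; apply: grid_meet_eq PQ PQ' _.
by have [x Jx] := cell_nonempty PJ; exists x; split; [exact: JQ|exact: JQ'].
Qed.

Lemma vol_descendant k i Q J : P k Q -> P (k + i)%N J -> J `<=` Q ->
  vol m J <= lambda2 ^+ i * vol m Q.
Proof.
have [l10 [l12 _]] := good_grid_lambda hP.
have l20 : 0 < lambda2 by exact: lt_trans l12.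
elim: i J => [|i IH] J PQ.
  rewrite addn0 expr0 mul1r => PJ JQ; rewrite (_ : J = Q)//.
  by apply: (@grid_ancestor_unique k 0 J) => //; rewrite addn0.
rewrite addnS => PJ JQ; have [J' PJ' JJ'] := good_grid_nested hP PJ.
(* The ancestor of the parent [J'] on level [k] also contains [J], hence it is [Q]. *)
have J'Q : J' `<=` Q.
  have [Q' PQ' J'Q'] := grid_ancestor PJ'.
  rewrite -addnS in PJ.
  rewrite (grid_ancestor_unique PJ PQ PQ' JQ)//.
  exact: subset_trans J'Q'.
have /andP[_] := good_grid_ratio hP PJ PJ' JJ'.
rewrite ler_pdivrMr ?(vol_gt0 PJ')// => h.
by rewrite (le_trans h)// exprS -mulrA ler_wpM2l ?(ltW l20)// IH.
Qed.

(** A cell on two levels would be its own descendant [i > 0] levels deeper, giving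
    [|Q| <= lambda2^i |Q|] although [|Q| > 0] and [lambda2 < 1]. *)
Lemma level_unique k j Q : P k Q -> P j Q -> k = j.
Proof.
wlog kj : k j / (k <= j)%N.
  move=> H PkQ PjQ; have [kj|jk] := leqP k j; first exact: H.
  by apply/esym; apply: H => //; exact: ltnW.
rewrite -(subnKC kj); move: (j - k)%N => i PkQ PjQ.
have := vol_descendant PkQ PjQ (@subset_refl _ Q).
have [l10 [l12 l21]] := good_grid_lambda hP.
have l20 : 0 < lambda2 by exact: lt_trans l12.
rewrite -[leLHS]mul1r ler_pM2r ?(vol_gt0 PkQ)//.
case: i PjQ => [|i] _; first by rewrite addn0.
by rewrite leNgt exprn_ilt1// ltW.
Qed.

Lemma subgridE k Q i : P k Q -> subgrid P Q i = P (k + i)%N `&` [set J | J `<=` Q].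
Proof.
move=> PQ; apply/seteqP; split=> [J [k0 [PQ0 PJ JQ]]|J [PJ JQ]]; last by exists k.
by rewrite (level_unique PQ PQ0).
Qed.

Definition level k : seq (set T) := finmap.enum_fset (fset_set (P k)).

Lemma level_uniq k : uniq (level k).
Proof. exact: finmap.fset_uniq. Qed.

Lemma mem_level k Q : Q \in level k <-> P k Q.
Proof.
have -> : (Q \in level k) = (Q \in P k) := in_fset_set (good_grid_finite hP k) Q.
by split=> [/set_mem|/mem_set].
Qed.

Lemma fsum_level (V : nmodType) k (F : set T -> V) :
  \sum_(Q \in P k) F Q = \sum_(Q <- level k) F Q.
Proof. by apply: fsbig_finite; exact: good_grid_finite hP k. Qed.

Lemma fsum_subgrid (V : nmodType) k i Q (F : set T -> V) : P k Q ->
  \sum_(J \in subgrid P Q i) F J = \sum_(J <- level (k + i) | `[< J `<=` Q >]) F J.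
Proof.
move=> PQ; rewrite (subgridE i PQ) fsbig_mkcondr fsum_level [RHS]big_mkcond/=.
by apply: eq_bigr => J _; congr (if _ then _ else _).
Qed.

(** Only the unique ancestor survives in the conditional sum. The monoid is quantified after [Q], so
    that one ancestor serves both the complex coefficients and their real bounds. *)
Lemma sum_ancestor k i J : P (k + i)%N J ->
  exists2 Q, P k Q /\ J `<=` Q & forall (V : nmodType) (F : set T -> V),
    \sum_(Q' <- level k | `[< J `<=` Q' >]) F Q' = F Q.
Proof.
move=> PJ; have [Q PQ JQ] := grid_ancestor PJ; exists Q => // V F.
rewrite big_mkcond/= (@big_seq_single _ _ _ Q) ?level_uniq//.
- by rewrite asboolT.
- exact/mem_level.
move=> Q' /mem_level PQ' /eqP Q'Q; rewrite asboolF// => JQ'.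
exact/Q'Q/(grid_ancestor_unique PJ).
Qed.

End Grid.

(** * Expansion of one Besov atom in indicators of cells *)

Lemma besov_const_inv_le1 (R : realType) (lambda beta : R) (q : \bar R) :
  (1 <= q)%E -> (fine (besov_const lambda beta q))^-1 <= 1.
Proof.
(* The series has first term 1, so the constant is at least 1. An infinite value is harmless: [fine]
   sends it to 0, whose inverse is 0. *)
move=> q1; suff : (1 <= besov_const lambda beta q)%E.
  case: (besov_const _ _ _) => [c| |] /=; rewrite ?invr0 ?ler01//.
  by rewrite lee_fin => c1; rewrite invf_le1// (lt_le_trans _ c1).
case: q q1 => [r| |] //=; rewrite lee_fin => r1.
have r0 : 0 < r by exact: lt_le_trans r1.
rewrite -[1%E](@poweR1r R r^-1); apply: ge0_le_poweR => //.
  by rewrite invr_ge0 ltW.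
apply: le_trans (nneseries_lim_ge 1 _); last by move=> k _ _; rewrite lee_fin powR_ge0.
by rewrite big_nat1 !mul0r powRr0.
Qed.

Lemma ae_eq_sum (R : realType) (d : measure_display) (T : measurableType d)
    (m : {measure set T -> \bar R}) (K : eqType) (r : seq K) (A : pred K)
    (F G : K -> T -> R[i]) :
  (forall i, i \in r -> A i -> F i = G i %[ae m]) ->
  (fun x => \sum_(i <- r | A i) F i x) = (fun x => \sum_(i <- r | A i) G i x) %[ae m].
Proof.
elim: r => [|i r IH] FG.
  by apply: nearW => x _; rewrite !big_nil.
have h1 := IH (fun j jr => FG j (mem_behead (s := i :: r) jr)).
case Ai : (A i); last first.
  by apply: filterS h1 => x + _ => /(_ I); rewrite !big_cons Ai.
have h2 := FG i (mem_head _ _) Ai.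
by apply: filterS2 h1 h2 => x + + _ => /(_ I) h1 /(_ I) h2; rewrite !big_cons Ai h1 h2.
Qed.

Section Expansion.
Context {R : realType} {d : measure_display} {T : measurableType d}.
Variable m : {finite_measure set T -> \bar R}.
Variables (lambda1 lambda2 : R) (P : nat -> set (set T)).
Hypothesis hP : good_grid m lambda1 lambda2 P.

(** The infimum defining the norm need not be attained; the slack [e] provides a representation of
    cost below [(1 + e) |Q|^(s - beta)]. This bounds each level separately, because an [l^qt] norm
    dominates every term, and the constants of the Souza atoms are absorbed into [y]. *)
Lemma besov_atom_expansion (s p beta e : R) (qt : \bar R) k Q (b : T -> R[i]) :
  1 <= p -> (1 <= qt)%E -> 0 < e -> P k Q ->
  besov_atoms m P lambda2 s beta p qt Q b ->
  exists y : set T -> R[i],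
    (forall i, (\sum_(J <- level P (k + i) | `[< J `<=` Q >])
        (normc (y J) * vol m J `^ (p^-1 - beta)) `^ p) `^ p^-1 <=
      (1 + e) * vol m Q `^ (s - beta)) /\
    cLnorm m p%:E (fun x => b x - \sum_(0 <= i < n)
        \sum_(J <- level P (k + i) | `[< J `<=` Q >]) y J * (\1_J x : R)%:C)
      @[n --> \oo] --> 0%E.
Proof.
move=> p1 qt1 e0 PQ [[[mb _] _] _ bnorm].
have p0 : 0 < p by exact: lt_le_trans p1.
have vQ : 0 < vol m Q `^ (s - beta) by rewrite powR_gt0// (vol_gt0 hP PQ).
have : (besov_norm m (subgrid P Q) (souza_atoms m beta p) p qt b <
        ((1 + e) * vol m Q `^ (s - beta))%:E)%E.
  apply: (le_lt_trans bnorm); rewrite lte_fin ltr_pM2r//.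
  by apply: (le_lt_trans (besov_const_inv_le1 _ _ qt1)); rewrite ltrDl.
move=> /ereal_inf_lt[_ [c [a [[aS _ cvg _] ->]]] cost_lt].
have sub J i : J \in level P (k + i) -> `[< J `<=` Q >] -> cells (subgrid P Q) J.
  by move=> /(mem_level hP) PJ /asboolP JQ; exists i, k.
have /choice[z hz] : forall J, exists z : R[i], cells (subgrid P Q) J ->
    a J = (fun x => z * (\1_J x : R)%:C) %[ae m] /\
    normc z <= vol m J `^ (beta - p^-1).
  move=> J; have [cJ|nJ] := pselect (cells (subgrid P Q) J); last by exists 0.
  by have [_ [z ?]] := aS _ cJ; exists z.
have ma J i : J \in level P (k + i) -> `[< J `<=` Q >] -> cmeasurable (a J).
  by move=> JL /(sub _ _ JL) cJ; have [] := aS _ cJ.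
exists (fun J => c J * z J); split=> [i|].
  apply: (@le_trans _ _ ((\sum_(J <- level P (k + i) | `[< J `<=` Q >])
      normc (c J) `^ p) `^ p^-1)).
    (* Since [|z J| <= |J|^(beta - 1/p)], the weight cancels this factor and leaves at most
       [|c J|]. *)
    apply: le_powR_sum => // J JL JQ; rewrite mulr_ge0 ?powR_ge0//=.
    have [_ zle] := hz J (sub _ _ JL JQ).
    have vJ := vol_gt0 hP ((mem_level hP _ _).1 JL).
    rewrite ComplexField.Normc.normcM -mulrA ler_piMr//.
    rewrite (le_trans (ler_wpM2r (powR_ge0 _ _) zle))//.
    rewrite -powRD; last by apply/implyP => _; rewrite gt_eqF.
    by rewrite addrA subrK subrr powRr0.
  rewrite -lee_fin; apply/ltW; apply: le_lt_trans cost_lt.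
  rewrite /cost; under [X in Lnorm _ _ X]eq_fun do rewrite (fsum_subgrid hP _ _ PQ).
  apply: (@lnorm_ge_term _ (fun i => (\sum_(J <- level P (k + i) | `[< J `<=` Q >])
      normc (c J) `^ p) `^ p^-1)) => // j.
  exact: powR_ge0.
(* Replacing the atoms by multiples of indicators alters the partial sums on a null set only, so the
   norms of the remainders are the same. *)
suff E n : cLnorm m p%:E (fun x => b x - \sum_(0 <= i < n)
      \sum_(J <- level P (k + i) | `[< J `<=` Q >]) (c J * z J) * (\1_J x : R)%:C) =
    cLnorm m p%:E (fun x => b x - \sum_(0 <= i < n) level_sum (subgrid P Q) c a i x).
  by under eq_fun do rewrite E; exact: cvg.
have Lx i : level_sum (subgrid P Q) c a i =
    fun x => \sum_(J <- level P (k + i) | `[< J `<=` Q >]) c J * a J x.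
  by apply/funext => x; rewrite /level_sum (fsum_subgrid hP _ _ PQ).
apply: ae_eq_cLnorm => //.
- apply: cmeasurableB => //; apply: cmeasurable_sum => i _.
  under eq_fun do rewrite -big_filter; apply: cmeasurable_sum => J.
  rewrite mem_filter => /andP[_ /(mem_level hP) PJ].
  apply: cmeasurableM; first exact: cmeasurable_cst.
  by apply: cmeasurable_indic; exact: (grid_measurable hP PJ).
- apply: cmeasurableB => //; apply: cmeasurable_sum => i _.
  rewrite Lx; under eq_fun do rewrite -big_filter; apply: cmeasurable_sum => J.
  rewrite mem_filter => /andP[JQ JL].
  by apply: cmeasurableM; [exact: cmeasurable_cst|exact: ma JL JQ].
suff : (fun x => \sum_(0 <= i < n)
      \sum_(J <- level P (k + i) | `[< J `<=` Q >]) (c J * z J) * (\1_J x : R)%:C) =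
    (fun x => \sum_(0 <= i < n) level_sum (subgrid P Q) c a i x) %[ae m].
  by apply: filterS => x + _ => /(_ I) /= ->.
apply: ae_eq_sum => i _ _; rewrite Lx.
apply: ae_eq_sum => J JL JQ; have [+ _] := hz J (sub _ _ JL JQ).
by apply: filterS => x + _ => /(_ I) /= ->; rewrite mulrA.
Qed.

End Expansion.

(** * Geometric series and a triangular rearrangement *)

Lemma powR_lt1 (R : realType) (x a : R) : 0 < x < 1 -> 0 < a -> 0 < x `^ a < 1.
Proof.
move=> /andP[x0 x1] a0; rewrite powR_gt0//= [ltRHS](_ : 1 = 1 `^ a); last by rewrite powR1.
by apply: gt0_ltr_powR; rewrite ?nnegrE// ltW.
Qed.

Lemma powR_exprn (R : realType) (x a : R) i : 0 <= x -> (x ^+ i) `^ a = (x `^ a) ^+ i.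
Proof.
move=> x0; elim: i => [|i IH]; first by rewrite !expr0 powR1.
by rewrite !exprS powRM ?exprn_ge0// IH.
Qed.

Lemma sum_geometric_le (R : realType) (x : R) (N n : nat) : 0 < x < 1 ->
  \sum_(N <= k < n) x ^+ k <= x ^+ N * (1 - x)^-1.
Proof.
move=> /andP[x0 x1]; have [Nn|/ltnW nN] := leqP N n; last first.
  by rewrite big_geq// mulr_ge0 ?exprn_ge0 ?ltW// invr_gt0 subr_gt0.
rewrite -(subnKC Nn) geometric_partial_tail geometric_le_lim ?exprn_ge0 ?(ltW x0)//.
by rewrite ger0_norm// ltW.
Qed.

(** Both sides run over the pairs with [k + i < n], grouped by the target level [k + i] on the left
    and by the source level [k] on the right. *)
Lemma sum_triangle (V : nmodType) (F : nat -> nat -> V) n :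
  \sum_(0 <= j < n) \sum_(0 <= k < j.+1) F k (j - k)%N =
  \sum_(0 <= k < n) \sum_(0 <= i < n - k) F k i.
Proof.
elim: n => [|n IH]; first by rewrite !big_nil.
rewrite big_nat_recr//= IH [RHS]big_nat_recr//= subSnn big_nat1.
rewrite [X in _ + X]big_nat_recr//= subnn addrA; congr (_ + _).
rewrite -big_split/= !big_nat; apply: eq_bigr => k /andP[_ kn].
by rewrite subSn ?(ltnW kn)// big_nat_recr.
Qed.

Lemma nneseries_geometric_lty (R : realType) (u : nat -> \bar R) (D x : R) :
  0 <= D -> 0 < x < 1 -> (forall k, 0 <= u k <= (D * x ^+ k)%:E)%E ->
  (\sum_(0 <= k <oo) u k < +oo)%E.
Proof.
move=> D0 x01 uD; apply: (@le_lt_trans _ _ (D * (1 - x)^-1)%:E); last exact: ltry.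
apply: lime_le.
  by apply: is_cvg_nneseries => k _ _; have /andP[] := uD k.
apply: nearW => n; apply: (@le_trans _ _ (\sum_(0 <= k < n) (D * x ^+ k)%:E)%E).
  by apply: lee_sum => k _; have /andP[] := uD k.
rewrite sumEFin lee_fin -mulr_sumr ler_wpM2l//.
by rewrite (le_trans (sum_geometric_le _ _ x01))// expr0 mul1r.
Qed.

(** * Level-wise bounds for transported coefficients and step functions *)

Section Synthesis.
Context {R : realType} {d : measure_display} {T : measurableType d}.
Variable m : {finite_measure set T -> \bar R}.
Variables (lambda1 lambda2 : R) (P : nat -> set (set T)).
Hypothesis hP : good_grid m lambda1 lambda2 P.
Variables (s p beta : R).
Hypotheses (s0 : 0 < s) (p1 : 1 <= p) (sbeta : s < beta).
Let p0 : 0 < p. Proof. exact: lt_le_trans p1. Qed.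
Let l20 : 0 < lambda2.
Proof. by have [l1 [l12 _]] := good_grid_lambda hP; exact: lt_trans l12. Qed.
Let l21 : lambda2 < 1. Proof. by have [_ [_]] := good_grid_lambda hP. Qed.
Let mu := lambda2 `^ (beta - s).
Let rho := lambda2 `^ s.

Let mu01 : 0 < mu < 1. Proof. by rewrite powR_lt1 ?l20// subr_gt0. Qed.
Let rho01 : 0 < rho < 1. Proof. by rewrite powR_lt1 ?l20. Qed.

(** This is [g_k(J)]: for [J] on level [k] or deeper the sum has one term, that of its ancestor.
    Written as a sum, it requires no choice of ancestor and can be exchanged with other sums. *)
Definition ancestor_coeff (c : set T -> R[i]) (y : set T -> set T -> R[i]) k J :=
  \sum_(Q <- level P k | `[< J `<=` Q >]) c Q * y Q J.

Definition level_cost (c : set T -> R[i]) k :=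
  (\sum_(Q <- level P k) normc (c Q) `^ p) `^ p^-1.

Lemma level_cost_ge0 c k : 0 <= level_cost c k.
Proof. exact: powR_ge0. Qed.

Lemma costE q c : cost P p q c = Lnorm (@counting nat R) q (fun k => (level_cost c k)%:E).
Proof. by apply: eq_Lnorm => k; rewrite (fsum_level hP). Qed.

(** Split the weight as [|J|^(1/p - beta) |J|^(beta - s)]. By volume decay the second factor is at
    most [mu^i |Q|^(beta - s)], whose power of [|Q|] cancels the one in the bound for the expansion
    of [Q]. *)
Lemma ancestor_coeff_bound c y K k i :
  0 <= K ->
  (forall Q, P k Q ->
    (\sum_(J <- level P (k + i) | `[< J `<=` Q >])
        (normc (y Q J) * vol m J `^ (p^-1 - beta)) `^ p) `^ p^-1 <=
      K * vol m Q `^ (s - beta)) ->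
  (\sum_(J <- level P (k + i)) (normc (ancestor_coeff c y k J) *
      vol m J `^ (p^-1 - s)) `^ p) `^ p^-1 <= K * mu ^+ i * level_cost c k.
Proof.
move=> K0 hy; have /andP[mu0 _] := mu01.
have mui : 0 <= mu ^+ i by rewrite exprn_ge0// ltW.
pose B Q J := (normc (y Q J) * vol m J `^ (p^-1 - beta)) `^ p.
have hB Q : P k Q -> \sum_(J <- level P (k + i) | `[< J `<=` Q >]) B Q J <=
    (K * vol m Q `^ (s - beta)) `^ p.
  move=> PQ; have -> : \sum_(J <- level P (k + i) | `[< J `<=` Q >]) B Q J =
      ((\sum_(J <- level P (k + i) | `[< J `<=` Q >]) B Q J) `^ p^-1) `^ p.
    rewrite -powRrM mulVf ?gt_eqF// powRr1//.
    by apply: sumr_ge0 => J _; exact: powR_ge0.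
  apply: ge0_ler_powR; rewrite ?nnegrE ?powR_ge0 ?(ltW p0)//; last exact: hy.
  by rewrite mulr_ge0// powR_ge0.
pose A Q := normc (c Q) * mu ^+ i * vol m Q `^ (beta - s).
have A0 Q : 0 <= A Q by rewrite !mulr_ge0 ?exprn_ge0 ?powR_ge0// ltW.
have -> : K * mu ^+ i * level_cost c k =
    ((K * mu ^+ i) `^ p * \sum_(Q <- level P k) normc (c Q) `^ p) `^ p^-1.
  rewrite powRM ?powR_ge0//; last by apply: sumr_ge0 => Q _; exact: powR_ge0.
  by rewrite -powRrM divff ?gt_eqF// powRr1// mulr_ge0// exprn_ge0// ltW.
apply: ge0_ler_powR; rewrite ?nnegrE ?invr_ge0 ?(ltW p0)//.
- by apply: sumr_ge0 => J _; exact: powR_ge0.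
- by rewrite mulr_ge0 ?powR_ge0//; apply: sumr_ge0 => Q _; exact: powR_ge0.
apply: (@le_trans _ _ (\sum_(J <- level P (k + i))
    \sum_(Q <- level P k | `[< J `<=` Q >]) A Q `^ p * B Q J)).
  rewrite big_seq [leRHS]big_seq; apply: ler_sum => J /(mem_level hP) PJ.
  have [Q [PQ JQ] sumQ] := sum_ancestor hP PJ.
  rewrite /ancestor_coeff !sumQ -powRM ?mulr_ge0 ?powR_ge0//.
  have vJ := vol_gt0 hP PJ; have vQ := vol_gt0 hP PQ.
  apply: ge0_ler_powR; rewrite ?nnegrE ?mulr_ge0 ?powR_ge0 ?(ltW p0)//.
  have -> : p^-1 - s = (p^-1 - beta) + (beta - s) by rewrite addrA subrK.
  rewrite powRD; last by apply/implyP => _; rewrite gt_eqF.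
  rewrite ComplexField.Normc.normcM.
  have le_v : vol m J `^ (beta - s) <= mu ^+ i * vol m Q `^ (beta - s).
    rewrite -powR_exprn ?(ltW l20)// -powRM ?exprn_ge0 ?(ltW l20) ?(ltW vQ)//.
    apply: ge0_ler_powR; rewrite ?nnegrE ?mulr_ge0 ?exprn_ge0 ?(ltW l20) ?(ltW vQ) ?(ltW vJ)//.
      by rewrite subr_ge0 ltW.
    exact: (vol_descendant hP PQ PJ JQ).
  set X := vol m J `^ _.
  rewrite (_ : _ * (X * _) = normc (c Q) * normc (y Q J) * X * vol m J `^ (beta - s));
    last by ring.
  rewrite (_ : A Q * _ = normc (c Q) * normc (y Q J) * X *
    (mu ^+ i * vol m Q `^ (beta - s))); last by rewrite /A; ring.
  by rewrite ler_wpM2l// !mulr_ge0// powR_ge0.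
(* Grouping the cells [J] by their ancestor [Q] makes [hB] applicable to each group. *)
rewrite (exchange_big_dep xpredT)//= mulr_sumr big_seq [leRHS]big_seq.
apply: ler_sum => Q /(mem_level hP) PQ.
rewrite -mulr_sumr (le_trans (ler_wpM2l (powR_ge0 _ _) (hB _ PQ)))//.
have vQ := vol_gt0 hP PQ.
rewrite -!powRM ?mulr_ge0 ?exprn_ge0 ?powR_ge0 ?(ltW mu0)//.
rewrite /A (_ : _ * _ * _ * _ = K * mu ^+ i * normc (c Q) *
  (vol m Q `^ (beta - s) * vol m Q `^ (s - beta))); last by ring.
rewrite -powRD; last by apply/implyP => _; rewrite gt_eqF.
by rewrite addrA subrK subrr powRr0 mulr1.
Qed.

(** Write [|J|^(1/p) = |J|^s |J|^(1/p - s)]; as [s > 0] and [|J| <= lambda2^j |I|], the first factor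
    is at most [rho^j |I|^s]. *)
Lemma cLnorm_level_step j w :
  (cLnorm m p%:E (step (level P j) w) <=
    (rho ^+ j * vol m setT `^ s *
     (\sum_(J <- level P j) (normc (w J) * vol m J `^ (p^-1 - s)) `^ p) `^ p^-1)%:E)%E.
Proof.
have /andP[rho0 _] := rho01.
have P0T : P 0%N setT by rewrite (good_grid_root hP).
have vT := vol_gt0 hP P0T.
rewrite (cLnorm_step m w p0) ?level_uniq//; last 2 first.
- by move=> Q /(mem_level hP)/(grid_measurable hP).
- by move=> Q J /(mem_level hP) PQ /(mem_level hP) PJ; exact: (grid_meet_eq hP PQ PJ).
rewrite lee_fin.
have D0 : 0 <= rho ^+ j * vol m setT `^ s.
  by rewrite mulr_ge0 ?powR_ge0// exprn_ge0// ltW.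
set Dj := rho ^+ j * _ in D0 *; set X := \sum_(J <- _) (_ * _ `^ (_ - s)) `^ p.
have X0 : 0 <= X by apply: sumr_ge0 => J _; exact: powR_ge0.
have -> : Dj * X `^ p^-1 = (Dj `^ p * X) `^ p^-1.
  by rewrite powRM ?powR_ge0// -powRrM divff ?gt_eqF// powRr1.
apply: ge0_ler_powR; rewrite ?nnegrE ?invr_ge0 ?(ltW p0)//.
- apply: sumr_ge0 => J _; rewrite mulr_ge0 ?powR_ge0// fine_ge0//.
- by rewrite mulr_ge0 ?powR_ge0.
rewrite /X mulr_sumr big_seq [leRHS]big_seq; apply: ler_sum => J /(mem_level hP) PJ.
have vJ := vol_gt0 hP PJ.
rewrite -powRM ?mulr_ge0 ?powR_ge0// ?exprn_ge0 ?(ltW rho0)//.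
rewrite [X in _ * X <= _](_ : vol m J = (vol m J `^ p^-1) `^ p); last first.
  by rewrite -powRrM mulVf ?gt_eqF// powRr1// ltW.
rewrite -powRM ?powR_ge0//.
apply: ge0_ler_powR; rewrite ?nnegrE ?mulr_ge0 ?powR_ge0 ?exprn_ge0 ?(ltW p0) ?(ltW rho0)//.
rewrite [leRHS]mulrCA ler_wpM2l//.
rewrite [in leLHS](_ : p^-1 = s + (p^-1 - s)); last by rewrite addrC subrK.
rewrite powRD; last by apply/implyP => _; rewrite gt_eqF.
rewrite ler_wpM2r ?powR_ge0//.
rewrite /Dj -powR_exprn ?(ltW l20)// -powRM ?exprn_ge0 ?(ltW l20) ?(ltW vT)//.
apply: ge0_ler_powR; rewrite ?nnegrE ?mulr_ge0 ?exprn_ge0 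
  ?(ltW l20) ?(ltW vT) ?(ltW vJ) ?(ltW s0)//.
exact: (vol_descendant (k := 0) hP P0T PJ).
Qed.

End Synthesis.

(** * Turning a representation by Besov's atoms into one by Souza's atoms *)

Section Resynthesis.
Context {R : realType} {d : measure_display} {T : measurableType d}.
Variable m : {finite_measure set T -> \bar R}.
Variables (lambda1 lambda2 : R) (P : nat -> set (set T)).
Hypothesis hP : good_grid m lambda1 lambda2 P.
Variables (s p beta : R).
Hypotheses (s0 : 0 < s) (p1 : 1 <= p) (sbeta : s < beta).
Let p0 : 0 < p. Proof. exact: lt_le_trans p1. Qed.

(** One expansion is chosen for each set [Q], independently of [k]; this is consistent because a
    cell has only one level. *)
Lemma besov_atoms_family_expansion (qt : \bar R) (e : R) (b : set T -> T -> R[i]) :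
  (1 <= qt)%E -> 0 < e ->
  (forall Q, cells P Q -> besov_atoms m P lambda2 s beta p qt Q (b Q)) ->
  exists y : set T -> set T -> R[i], forall k Q, P k Q ->
    (forall i, (\sum_(J <- level P (k + i) | `[< J `<=` Q >])
        (normc (y Q J) * vol m J `^ (p^-1 - beta)) `^ p) `^ p^-1 <=
      (1 + e) * vol m Q `^ (s - beta)) /\
    cLnorm m p%:E (fun x => b Q x - \sum_(0 <= i < n)
        \sum_(J <- level P (k + i) | `[< J `<=` Q >]) y Q J * (\1_J x : R)%:C)
      @[n --> \oo] --> 0%E.
Proof.
move=> qt1 e0 hb.
suff /choice[y hy] : forall Q, exists y : set T -> R[i], forall k, P k Q ->
    (forall i, (\sum_(J <- level P (k + i) | `[< J `<=` Q >])
        (normc (y J) * vol m J `^ (p^-1 - beta)) `^ p) `^ p^-1 <=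
      (1 + e) * vol m Q `^ (s - beta)) /\
    cLnorm m p%:E (fun x => b Q x - \sum_(0 <= i < n)
        \sum_(J <- level P (k + i) | `[< J `<=` Q >]) y J * (\1_J x : R)%:C)
      @[n --> \oo] --> 0%E.
  by exists y => k Q; exact: hy.
move=> Q; have [[k PQ]|nQ] := pselect (cells P Q); last first.
  by exists (fun=> 0) => k PQ; exfalso; apply: nQ; exists k.
have [y hy] := besov_atom_expansion hP p1 qt1 e0 PQ (hb _ (ex_intro _ k PQ)).
by exists y => j PjQ; rewrite -(level_unique hP PQ PjQ).
Qed.

Lemma ancestor_coeff_step c y k i x :
  \sum_(Q <- level P k) c Q * (\sum_(J <- level P (k + i) | `[< J `<=` Q >])
      y Q J * (\1_J x : R)%:C) =
  step (level P (k + i)) (ancestor_coeff P c y k) x.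
Proof.
under eq_bigr do rewrite mulr_sumr.
rewrite (exchange_big_dep xpredT)//=; apply: eq_bigr => J _.
by rewrite mulr_suml; apply: eq_bigr => Q _; rewrite mulrA.
Qed.

(** A level sum is a finite combination of atoms, so its remainder is the same combination of the
    remainders [H Q n], each of which tends to 0 in [L^p]. *)
Lemma resynthesis_level_cvg c b y k :
  (forall Q, P k Q -> cmeasurable (b Q)) ->
  (forall Q, P k Q -> cLnorm m p%:E (fun x => b Q x - \sum_(0 <= i < n)
        \sum_(J <- level P (k + i) | `[< J `<=` Q >]) y Q J * (\1_J x : R)%:C)
      @[n --> \oo] --> 0%E) ->
  cLnorm m p%:E (fun x => level_sum P c b k x - \sum_(0 <= i < n)
        step (level P (k + i)) (ancestor_coeff P c y k) x)
      @[n --> \oo] --> 0%E.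
Proof.
move=> mb hb.
pose H Q n x := b Q x - \sum_(0 <= i < n)
        \sum_(J <- level P (k + i) | `[< J `<=` Q >]) y Q J * (\1_J x : R)%:C.
have mH Q n : Q \in level P k -> cmeasurable (H Q n).
  move=> /(mem_level hP) PQ; apply: cmeasurableB; first exact: mb.
  apply: cmeasurable_sum => i _; under eq_fun do rewrite -big_filter.
  apply: cmeasurable_sum => J; rewrite mem_filter => /andP[_ /(mem_level hP) PJ].
  apply: cmeasurableM; first exact: cmeasurable_cst.
  by apply: cmeasurable_indic; exact: (grid_measurable hP PJ).
have -> : (fun n => cLnorm m p%:E (fun x => level_sum P c b k x - \sum_(0 <= i < n)
        step (level P (k + i)) (ancestor_coeff P c y k) x)) =
    (fun n => cLnorm m p%:E (fun x => \sum_(Q <- level P k) c Q * H Q n x)).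
  apply/funext => n; apply: eq_cLnorm => x.
  under [RHS]eq_bigr do rewrite mulrBr.
  rewrite sumrB /level_sum (fsum_level hP); congr (_ - _).
  under [RHS]eq_bigr do rewrite mulr_sumr.
  by rewrite exchange_big; apply: eq_bigr => i _; rewrite -ancestor_coeff_step.
apply: (@squeeze_cvge _ _ _ _ (fun=> 0%E) _
  (fun n => \sum_(Q <- level P k) ((normc (c Q))%:E * cLnorm m p%:E (H Q n)))%E).
- apply: nearW => n; rewrite cLnorm_ge0/=.
  apply: le_trans (cLnorm_sum m (F := fun Q x => c Q * H Q n x) p1 _) _.
    by move=> Q QL; apply: cmeasurableM; [exact: cmeasurable_cst|exact: mH].
  rewrite big_seq [leRHS]big_seq; apply: lee_sum => Q QL.
  by rewrite cLnormZ//; exact: mH.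
- exact: cvg_cst.
rewrite [X in _ --> X](_ : 0%E = \sum_(Q <- level P k | Q \in level P k) 0%E)%E; last first.
  by rewrite big1.
under eq_fun do rewrite big_seq.
apply: cvg_nnesum => Q QL.
  by apply: nearW => n; rewrite mule_ge0 ?lee_fin ?cLnorm_ge0.
rewrite -[X in _ --> X](mule0 (normc (c Q))%:E).
by apply: cvgeZl => //; apply: hb; exact/(mem_level hP).
Qed.

(** The conclusion is about representations, so that it gives both an inclusion of spaces and a
    comparison of norms. The factor [1 + e] pays for nearly optimal expansions of the atoms and is
    removed in the theorem. *)
Lemma besov_atoms_resynthesis (q qt : \bar R) (e : R) c b f :
  (1 <= q)%E -> (1 <= qt)%E -> 0 < e -> cmeasurable f ->
  representation m P (besov_atoms m P lambda2 s beta p qt) p q f c b ->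
  exists c' a', representation m P (souza_atoms m s p) p q f c' a' /\
    (cost P p q c' <= ((1 + e) * (1 - lambda2 `^ (beta - s))^-1)%:E * cost P p q c)%E.
Proof.
move=> q1 qt1 e0 mf [hb _ fcvg coo].
have [_ [_ l21]] := good_grid_lambda hP.
have l20 : 0 < lambda2.
  by have [l1 [l12 _]] := good_grid_lambda hP; exact: lt_trans l12.
have [y hy] := besov_atoms_family_expansion qt1 e0 hb.
set mu := lambda2 `^ (beta - s); pose rho := lambda2 `^ s.
have mu01 : 0 < mu < 1 by rewrite powR_lt1 ?l20// subr_gt0.
have rho01 : 0 < rho < 1 by rewrite powR_lt1 ?l20.
have /andP[mu0 mu1] := mu01; have /andP[rho0 rho1] := rho01.
pose K := 1 + e; have K0 : 0 <= K by rewrite addr_ge0// ltW.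
pose g := ancestor_coeff P c y.
(* [G k i] is the part on level [k + i] of the expansion of the level sum [F k]. *)
pose G k i := step (level P (k + i)) (g k).
pose F := level_sum P c b.
have mb Q k : P k Q -> cmeasurable (b Q).
  by move=> PQ; have [[[]]] := hb _ (ex_intro _ k PQ).
have mF k : cmeasurable (F k).
  rewrite /F/level_sum; under eq_fun do rewrite (fsum_level hP).
  apply: cmeasurable_sum => Q /(mem_level hP) PQ.
  by apply: cmeasurableM; [exact: cmeasurable_cst|exact: mb PQ].
have mG k i : cmeasurable (G k i).
  by apply: cmeasurable_step => Q /(mem_level hP)/(grid_measurable hP).
pose S := level_cost P p c; have S_ge0 k : 0 <= S k by exact: level_cost_ge0.
have gS k i : (\sum_(J <- level P (k + i)) (normc (g k J) *
      vol m J `^ (p^-1 - s)) `^ p) `^ p^-1 <= K * mu ^+ i * S k.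
  by apply: (ancestor_coeff_bound hP p1 sbeta c K0) => Q PQ; have [] := hy _ _ PQ.
have costS : cost P p q c = Lnorm (@counting nat R) q (fun k => (S k)%:E).
  exact: (costE hP).
rewrite costS in coo *.
have lf : Lnorm (@counting nat R) q (fun k => (S k)%:E) \is a fin_num.
  by rewrite ge0_fin_numE// Lnorm_ge0.
pose B := fine (Lnorm (@counting nat R) q (fun k => (S k)%:E)).
have SB k : S k <= B by rewrite -lee_fin fineK//; exact: lnorm_ge_term.
have B0 : 0 <= B by rewrite (le_trans (S_ge0 0%N)).
(* In [D], the volume factor comes from [cLnorm_level_step], [K] from the expansions of the atoms,
   and [B] bounds all [S k] at once. *)
pose D := vol m setT `^ s * K * B.
have D0 : 0 <= D by rewrite !mulr_ge0 ?powR_ge0.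
have GD k i : (cLnorm m p%:E (G k i) <= (D * rho ^+ (k + i) * mu ^+ i)%:E)%E.
  apply: le_trans (cLnorm_level_step hP s0 p1 _ _) _.
  rewrite lee_fin (le_trans (ler_wpM2l _ (gS k i)))//.
    by rewrite mulr_ge0 ?powR_ge0// exprn_ge0// ltW.
  rewrite (_ : D * _ * _ = rho ^+ (k + i) * vol m setT `^ s * (K * mu ^+ i * B));
    last by rewrite /D; ring.
  by rewrite !ler_wpM2l// ?mulr_ge0 ?powR_ge0// ?exprn_ge0 ?(ltW rho0) ?(ltW mu0).
have rm01 : 0 < rho * mu < 1.
  by rewrite mulr_gt0//= mulr_ilt1 ?(ltW rho0) ?(ltW mu0).
(* Compare with a later cut [M]: the remainder at [M] tends to 0, and the terms from [N] to [M] are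
   dominated by a geometric series of ratio [rho * mu], uniformly in [M]. *)
have tail k N : (cLnorm m p%:E (fun x => F k x - \sum_(0 <= i < N) G k i x)%R <=
    (D / (1 - rho * mu) * rho ^+ (k + N) * mu ^+ N)%:E)%E.
  have cvgF := @resynthesis_level_cvg c b y k (fun Q => @mb Q k)
    (fun Q PQ => (hy _ _ PQ).2).
  set X := (X in (_ <= X)%E).
  suff : (cLnorm m p%:E (fun x => F k x - \sum_(0 <= i < N) G k i x)%R <= 0 + X)%E.
    by rewrite add0e.
  apply: (cvge_to_ge (cvgeD _ cvgF (cvg_cst X))); first by rewrite fin_num_adde_defl.
  exists N => // M /= NM.
  rewrite (eq_cLnorm _ _ (g := fun x => (F k x - \sum_(0 <= i < M) G k i x) +
    \sum_(N <= i < M) G k i x)); last first.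
    by move=> x; rewrite (big_cat_nat (n := N) (p := M))//= opprD addrA addrNK.
  apply: le_trans (cLnormD m p1 _ _) _.
  - by apply: cmeasurableB => //; apply: cmeasurable_sum.
  - by apply: cmeasurable_sum.
  rewrite leeD2l//; apply: le_trans (cLnorm_sum m p1 _) _ => //.
  apply: (@le_trans _ _ (\sum_(N <= i < M) (D * rho ^+ (k + i) * mu ^+ i)%:E)%E).
    exact: lee_sum.
  rewrite sumEFin lee_fin.
  under eq_bigr => i _ do rewrite exprD mulrA -mulrA -exprMn.
  rewrite -mulr_sumr (le_trans (ler_wpM2l _ (sum_geometric_le _ _ rm01)))//.
    by rewrite mulr_ge0 ?exprn_ge0 ?(ltW rho0).
  by rewrite exprD exprMn le_eqVlt; apply/orP; left; apply/eqP; ring.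
(* The level of a cell, with default 0 off the grid. *)
pose lev J := xget 0%N [set k | P k J].
have levE k J : P k J -> lev J = k.
  by move=> PJ; apply: xget_unique => // j PjJ; exact: (level_unique hP PjJ PJ).
(* [a' J] is the largest positive Souza atom on [J], and the power of [|J|] in [c' J] undoes its
   height. Thus [c' J * a' J] is the indicator of [J] times the sum of the contributions of all
   levels up to that of [J]. *)
pose c' J := (\sum_(0 <= k < (lev J).+1) g k J) * (vol m J `^ (p^-1 - s))%:C.
pose a' J := fun x : T => (vol m J `^ (s - p^-1))%:C * (\1_J x : R)%:C.
have levelE j : level_sum P c' a' j = fun x => \sum_(0 <= k < j.+1) G k (j - k)%N x.
  apply/funext => x; rewrite /level_sum (fsum_level hP).
  transitivity (\sum_(0 <= k < j.+1) \sum_(J <- level P j) g k J * (\1_J x : R)%:C).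
    rewrite exchange_big/= big_seq [RHS]big_seq; apply: eq_bigr => J /(mem_level hP) PJ.
    rewrite /c' (levE _ _ PJ) /a' -mulrA -mulr_suml; congr (_ * _).
    rewrite mulrA -rmorphM -powRD; last first.
      by apply/implyP => _; rewrite gt_eqF// (vol_gt0 hP PJ).
    by rewrite addrA subrK subrr powRr0 rmorph1 mul1r.
  rewrite big_nat [RHS]big_nat; apply: eq_bigr => k /andP[_ kj].
  by rewrite /G /step subnKC.
pose V j := \sum_(0 <= k < j.+1) mu ^+ (j - k) * S k.
have V_ge0 j : 0 <= V j.
  by apply: sumr_ge0 => k _; rewrite mulr_ge0// exprn_ge0// ltW.
have c'V j : level_cost P p c' j <= K * V j.
  apply: (@le_trans _ _ ((\sum_(J <- level P j)
      (\sum_(0 <= k < j.+1) normc (g k J) * vol m J `^ (p^-1 - s)) `^ p) `^ p^-1)).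
    apply: le_powR_sum => // J /(mem_level hP) PJ _; rewrite normc_ge0/=.
    rewrite /c' (levE _ _ PJ) ComplexField.Normc.normcM normc_real ger0_norm ?powR_ge0//.
    by rewrite -mulr_suml ler_wpM2r ?powR_ge0// ler_normc_sum.
  apply: le_trans (ler_minkowski_sum _ _ p1 _) _.
    by move=> k J; rewrite mulr_ge0// powR_ge0.
  rewrite /V mulr_sumr big_nat [leRHS]big_nat; apply: ler_sum => k /andP[_ kj].
  by rewrite mulrA; have := gS k (j - k)%N; rewrite subnKC.
have VS : (Lnorm (@counting nat R) q (fun k => (V k)%:E) <=
    (1 - mu)^-1%:E * Lnorm (@counting nat R) q (fun k => (S k)%:E))%E.
  apply: lnorm_geometric_convolution => //.
  - by rewrite (ltW mu0).
  - by rewrite /V big_nat1 subnn expr0 mul1r lexx.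
  move=> n; rewrite /V big_nat_recr//= subnn expr0 mul1r lerD2r mulr_sumr.
  rewrite big_nat [leRHS]big_nat; apply: ler_sum => k /andP[_ kn].
  by rewrite subSn// exprS mulrA.
have Voo : (Lnorm (@counting nat R) q (fun k => (V k)%:E) < +oo)%E.
  by apply: (le_lt_trans VS); rewrite -(fineK lf) -EFinM ltry.
have cost_c' : (cost P p q c' <= K%:E * Lnorm (@counting nat R) q (fun k => (V k)%:E))%E.
  rewrite (costE hP); apply: lnorm_le_scale => // k.
  by rewrite level_cost_ge0 c'V.
exists c', a'; split; last first.
  apply: (le_trans cost_c'); rewrite EFinM -muleA.
  by rewrite lee_wpmul2l// lee_fin.
split.
- move=> J [k PJ]; split.
    apply: cmeasurableM; first exact: cmeasurable_cst.
    by apply: cmeasurable_indic; exact: (grid_measurable hP PJ).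
  exists (vol m J `^ (s - p^-1))%:C; split; first exact: nearW.
  by rewrite normc_real ger0_norm// powR_ge0.
(* All contributions to level [j] carry the same factor [rho^j], and their powers of [mu] sum to at
   most [1 / (1 - mu)]. *)
- apply: (@nneseries_geometric_lty _ _ (D / (1 - mu)) rho) => // [|j].
    by rewrite mulr_ge0// invr_ge0 subr_ge0 ltW.
  rewrite cLnorm_ge0/= levelE; apply: le_trans (cLnorm_sum m p1 _) _ => //.
  apply: (@le_trans _ _ (\sum_(0 <= k < j.+1) (D * rho ^+ j * mu ^+ (j - k))%:E)%E).
    rewrite big_nat [leRHS]big_nat; apply: lee_sum => k /andP[_ kj].
    by have := GD k (j - k)%N; rewrite subnKC.
  rewrite sumEFin lee_fin -mulr_sumr big_nat_rev/= add0n.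
  under eq_big_nat => k /andP[_ kj] do rewrite subSS subKn//.
  rewrite (le_trans (ler_wpM2l _ (sum_geometric_le _ _ mu01)))//.
    by rewrite mulr_ge0 ?exprn_ge0 ?(ltW rho0).
  by rewrite expr0 mul1r mulrAC.
- pose C := D / (1 - rho * mu) / (1 - mu).
  (* After [n] levels, the new remainder is the old one plus the tails of the expansions of [F k],
     cut at [n - k], for [k < n]. By [tail] these add up to at most [C * rho^n]. *)
  have lim0 : (cLnorm m p%:E (fun x => f x - \sum_(0 <= k < n) F k x)%R +
      (C * rho ^+ n)%:E)%E @[n --> \oo] --> 0%E.
    rewrite -[X in _ --> X](adde0 0%E); apply: cvgeD => //.
    apply: cvg_EFin; first exact: nearW.
    rewrite -(mulr0 C); apply: cvgMl_tmp; apply: cvg_expr.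
    by rewrite ger0_norm// ltW.
  apply: squeeze_cvge (cvg_cst 0%E) lim0; apply: nearW => n.
  rewrite cLnorm_ge0/=.
  rewrite (eq_cLnorm _ _ (g := fun x => (f x - \sum_(0 <= k < n) F k x) +
    \sum_(0 <= k < n) (F k x - \sum_(0 <= i < n - k) G k i x))); last first.
    move=> x; rewrite sumrB addrA subrK -(sum_triangle (fun k i => G k i x)).
    by congr (_ - _); apply: eq_bigr => j _; rewrite levelE.
  have mFG k : cmeasurable (fun x => F k x - \sum_(0 <= i < n - k) G k i x).
    by apply: cmeasurableB => //; apply: cmeasurable_sum.
  apply: le_trans (cLnormD m p1 _ _) _.
  - by apply: cmeasurableB => //; apply: cmeasurable_sum.
  - by apply: cmeasurable_sum.
  rewrite leeD2l//; apply: le_trans (cLnorm_sum m p1 _) _ => //.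
  apply: (@le_trans _ _ (\sum_(0 <= k < n)
      (D / (1 - rho * mu) * rho ^+ n * mu ^+ (n - k))%:E)%E).
    rewrite big_nat [leRHS]big_nat; apply: lee_sum => k /andP[_ kn].
    by have := tail k (n - k)%N; rewrite subnKC// ltnW.
  rewrite sumEFin lee_fin -mulr_sumr big_nat_rev/= add0n.
  have DC : 0 <= D / (1 - rho * mu).
    by rewrite mulr_ge0// invr_ge0 subr_ge0 ltW//; case/andP: rm01.
  rewrite /C [leRHS]mulrAC ler_wpM2l//.
    by rewrite mulr_ge0// exprn_ge0// ltW.
  (* The exponents of [mu] run from 1 to [n]; one factor [mu] is dropped to compare with the series
     starting at 0. *)
  apply: (@le_trans _ _ (\sum_(0 <= k < n) mu ^+ k)).
    rewrite big_nat [leRHS]big_nat; apply: ler_sum => k /andP[_ kn].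
    by rewrite subKn// exprS ler_piMl ?exprn_ge0 ?(ltW mu0) ?(ltW mu1).
  by rewrite (le_trans (sum_geometric_le _ _ mu01))// expr0 mul1r.
- apply: (le_lt_trans cost_c').
  by rewrite lte_mul_pinfty// ?lee_fin.
Qed.

End Resynthesis.

(** * Comparison of representations and norms for two families of atoms *)

Section Comparison.
Context {R : realType} {d : measure_display} {T : measurableType d}.
Variable m : {finite_measure set T -> \bar R}.
Variables (lambda1 lambda2 : R) (P : nat -> set (set T)).
Hypothesis hP : good_grid m lambda1 lambda2 P.
Variables (p : R) (q : \bar R).
Hypotheses (p1 : 1 <= p) (q1 : (1 <= q)%E).
Implicit Types (A : set T -> set (T -> R[i])) (K : R).

(** Moving the factor [K] from the atoms to the coefficients preserves every product, hence all
    level sums and their convergence. No division by [K] occurs, so [K = 0] is covered. *)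
Lemma representation_scale A1 A2 K f c a : 0 <= K ->
  (forall Q, cells P Q -> A1 Q `<=` scale_set K (A2 Q)) ->
  representation m P A1 p q f c a ->
  exists c' a', representation m P A2 p q f c' a' /\
    (cost P p q c' <= K%:E * cost P p q c)%E.
Proof.
move=> K0 A12 [aA asum acvg coo].
have p0 : 0 < p by exact: lt_le_trans p1.
have /choice[a' ha'] Q : exists a'Q, cells P Q ->
    A2 Q a'Q /\ a Q = (fun x => K%:C * a'Q x).
  have [PQ|nPQ] := pselect (cells P Q); last by exists (fun=> 0).
  by have [b Ab ba] := A12 _ PQ _ (aA _ PQ); exists b.
pose c' Q := K%:C * c Q.
have levelE : level_sum P c' a' = level_sum P c a.
  apply/funext => k; apply/funext => x; apply: eq_fsbigr => Q /set_mem PQ.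
  have [_ ->] := ha' Q (ex_intro _ k PQ).
  by rewrite /c' mulrAC mulrC.
have cost_le : (cost P p q c' <= K%:E * cost P p q c)%E.
  rewrite !(costE hP); apply: lnorm_le_scale => //.
  - by move=> k; exact: level_cost_ge0.
  - move=> k; rewrite level_cost_ge0/= /level_cost /c'.
    under eq_bigr do rewrite ComplexField.Normc.normcM normc_real ger0_norm// powRM//.
    rewrite -mulr_sumr powRM ?powR_ge0//; last by apply: sumr_ge0 => Q _; exact: powR_ge0.
    by rewrite -powRrM divff ?gt_eqF// powRr1.
  by rewrite -(costE hP).
exists c', a'; split; [split|exact: cost_le].
- by move=> Q PQ; have [] := ha' Q PQ.
- rewrite levelE; exact: asum.
- rewrite levelE; exact: acvg.
- apply: (le_lt_trans cost_le).
  by rewrite lte_mul_pinfty// ?lee_fin.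
Qed.

Lemma besov_norm_le A1 A2 K f : 0 <= K -> besov_space m P A1 p q f ->
  (forall c a, representation m P A1 p q f c a ->
    exists c' a', representation m P A2 p q f c' a' /\
      (cost P p q c' <= K%:E * cost P p q c)%E) ->
  (besov_norm m P A2 p q f <= K%:E * besov_norm m P A1 p q f)%E.
Proof.
move=> K0 [_ [c0 [a0 rep0]]] h.
have le_cost c a : representation m P A1 p q f c a ->
    (besov_norm m P A2 p q f <= K%:E * cost P p q c)%E.
  move=> /h[c' [a' [rep']]]; apply: le_trans.
  by apply: ereal_inf_lbound; exists c', a'.
(* For [K = 0] the representation supplied by membership already bounds the left norm by 0; for
   [K > 0] one divides by [K] and takes the infimum. *)
move: K0; rewrite le_eqVlt => /predU1P[K0|K0].
  by have := le_cost _ _ rep0; rewrite -K0 !mul0e.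
rewrite -lee_pdivrMl//; apply: le_ereal_inf_tmp => _ [c [a [rep ->]]].
by rewrite lee_pdivrMl//; exact: le_cost rep.
Qed.

Lemma besov_norm_fin_num A f : besov_space m P A p q f ->
  besov_norm m P A p q f \is a fin_num.
Proof.
move=> [_ [c [a rep]]]; have [_ _ _ coo] := rep.
rewrite ge0_fin_numE.
  by apply: le_lt_trans coo; apply: ereal_inf_lbound; exists c, a.
apply: le_ereal_inf_tmp => _ [c' [a' [_ ->]]]; exact: Lnorm_ge0.
Qed.

End Comparison.

(** * Equality of the three spaces and the two norm bounds *)

Theorem proposition16p1 (R : realType) (d : measure_display)
    (T : measurableType d) (m : {finite_measure set T -> \bar R})
    (lambda1 lambda2 : R) (P : nat -> set (set T))
    (hP : good_grid m lambda1 lambda2 P)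
    (s p : R) (q u : \bar R)
    (hs : 0 < s) (hp : 1 <= p) (hq : (1 <= q)%E) (hu : (1 <= u)%E)
    (A : atom_class m P s p u)
    (beta : R) (qt : \bar R) (K1 K2 : R)
    (hbeta : s < beta) (hqt : (1 <= qt)%E) (hK1 : 0 < K1) (hK2 : 0 <= K2)
    (hA : forall Q : set T, cells P Q ->
       scale_set (1 / K1) (souza_atoms m s p Q) `<=` ac_atoms A Q /\
       ac_atoms A Q `<=`
         scale_set K2 (besov_atoms m P lambda2 s beta p qt Q)) :
  [/\ besov_space m P (souza_atoms m s p) p q =
        besov_space m P (ac_atoms A) p q,
      besov_space m P (ac_atoms A) p q =
        besov_space m P (besov_atoms m P lambda2 s beta p qt) p q,
      forall f : T -> R[i], besov_space m P (ac_atoms A) p q f ->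
        (besov_norm m P (ac_atoms A) p q f <=
         K1%:E * besov_norm m P (souza_atoms m s p) p q f)%E
    & forall f : T -> R[i], besov_space m P (ac_atoms A) p q f ->
        (besov_norm m P (souza_atoms m s p) p q f <=
         (K2 / (1 - lambda2 `^ (beta - s)))%:E *
           besov_norm m P (ac_atoms A) p q f)%E].
Proof.
pose sz := souza_atoms m s p; pose at_ := ac_atoms A.
pose bs := besov_atoms m P lambda2 s beta p qt.
(* As [K1 > 0], the first inclusion can be inverted into the form required by
   [representation_scale]. *)
have sz_at Q : cells P Q -> sz Q `<=` scale_set K1 (at_ Q).
  move=> PQ a aQ; exists (fun x => (1 / K1)%:C * a x).
    by apply: (hA Q PQ).1; exists a.
  apply/funext => x; rewrite mulrA -rmorphM mul1r divff ?gt_eqF//.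
  by rewrite rmorph1 mul1r.
have at_bs Q : cells P Q -> at_ Q `<=` scale_set K2 (bs Q).
  by move=> PQ; exact: (hA Q PQ).2.
have rep_sz_at f c a := @representation_scale _ _ _ _ _ _ _ hP p q hp hq sz at_ K1 f c a
  (ltW hK1) sz_at.
have rep_at_bs f c a := @representation_scale _ _ _ _ _ _ _ hP p q hp hq at_ bs K2 f c a
  hK2 at_bs.
have rep_bs_sz e f c b := @besov_atoms_resynthesis _ _ _ _ _ _ _ hP s p beta hs hp hbeta
  q qt e c b f hq hqt.
(* The three inclusions form a cycle, from which both equalities follow; the last one uses the
   resynthesis with [e = 1]. *)
have sub_sz_at : besov_space m P sz p q `<=` besov_space m P at_ p q.
  move=> f [Lf [c [a /rep_sz_at[c' [a' [rep _]]]]]].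
  by split; [exact: Lf|exists c', a'].
have sub_at_bs : besov_space m P at_ p q `<=` besov_space m P bs p q.
  move=> f [Lf [c [a /rep_at_bs[c' [a' [rep _]]]]]].
  by split; [exact: Lf|exists c', a'].
have sub_bs_sz : besov_space m P bs p q `<=` besov_space m P sz p q.
  move=> f [Lf [c [a /(rep_bs_sz _ _ _ _ ltr01 Lf.1)[c' [a' [rep _]]]]]].
  by split; [exact: Lf|exists c', a'].
have sz_at_eq : besov_space m P sz p q = besov_space m P at_ p q.
  by apply/seteqP; split; [exact: sub_sz_at|move=> f /sub_at_bs/sub_bs_sz].
have at_bs_eq : besov_space m P at_ p q = besov_space m P bs p q.
  by apply/seteqP; split; [exact: sub_at_bs|move=> f /sub_bs_sz/sub_sz_at].
split; [exact: sz_at_eq|exact: at_bs_eq| |] => f fA.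
  apply: besov_norm_le; first exact: ltW.
    by rewrite -/sz sz_at_eq.
  by move=> c a; exact: rep_sz_at.
have [_ [_ l21]] := good_grid_lambda hP.
have l20 : 0 < lambda2.
  by have [l1 [l12 _]] := good_grid_lambda hP; exact: lt_trans l12.
set mu := lambda2 `^ (beta - s).
have /andP[_ mu1] : 0 < mu < 1 by rewrite powR_lt1 ?l20// subr_gt0.
have nfin := besov_norm_fin_num fA.
have N0 : 0 <= fine (besov_norm m P at_ p q f).
  rewrite fine_ge0//; apply: le_ereal_inf_tmp => _ [c [a [_ ->]]]; exact: Lnorm_ge0.
set C := K2 / (1 - mu); have C0 : 0 <= C by rewrite divr_ge0// subr_ge0 ltW.
(* A representation by [A] becomes one by Besov's atoms at the price [K2], then one by Souza's atoms
   at the price [(1 + e) / (1 - mu)]. *)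
have norm_le e : 0 < e ->
    (besov_norm m P sz p q f <= ((1 + e) * C)%:E * besov_norm m P at_ p q f)%E.
  move=> e0; apply: besov_norm_le; first by rewrite mulr_ge0// addr_ge0// ltW.
    exact: fA.
  move=> c a /rep_at_bs[c' [a' [rep' cost']]].
  have [c'' [a'' [rep'' cost'']]] := rep_bs_sz _ _ _ _ e0 fA.1.1 rep'.
  exists c'', a''; split; [exact: rep''|apply: (le_trans cost'')].
  apply: (@le_trans _ _ (((1 + e) * (1 - mu)^-1)%:E * (K2%:E * cost P p q c))%E).
    apply: lee_wpmul2l cost'; rewrite lee_fin.
    by rewrite mulr_ge0 ?invr_ge0 ?subr_ge0 ?(ltW mu1)// addr_ge0// ltW.
  by rewrite muleA -EFinM -mulrA [(1 - mu)^-1 * K2]mulrC lexx.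
apply/lee_addgt0Pr => e e0.
set N := fine _ in N0; have CN0 : 0 <= C * N by rewrite mulr_ge0.
(* With this slack the excess over [C * N] is [C * N * e / (C * N + 1) <= e]; the added 1 keeps the
   denominator positive. *)
have d0 : 0 < e / (C * N + 1) by rewrite divr_gt0// ltr_wpDl.
apply: (le_trans (norm_le _ d0)).
rewrite -(fineK nfin) -/at_ -/N -!EFinM -EFinD lee_fin.
rewrite -mulrA mulrDl mul1r lerD2l mulrAC ler_pdivrMr ?ltr_wpDl//.
by rewrite ler_wpM2l ?(ltW e0)// lerDl.
Qed.
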